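(* Let $\mathcal{A}$ be a non-trivial amenable family of functors into a category $\mathcal{C}$, let $n\ge1$, and suppose $\mathcal{A}$ has $(n+1)$-complete amalgamation. Then for every $B\in\operatorname{Ob}(\mathcal{C})$, $$H_n(\mathcal{A};B)=\{[c]: c\text{ is an }n\text{-shell over }B\text{ with support }[n+1]\}.$$
   Context: For finite $s\subseteq\omega$, $\mathcal{P}(s)$ is the power set of $s$ as a category (one morphism $\iota_{u,v}:u\to v$ when $u\subseteq v$); $X\subseteq\mathcal{P}(s)$ is downward closed if $u\subseteq v\in X$ implies $u\in X$. For $t\in X$, $X|_t=\{u\in\mathcal{P}(s\setminus t):t\cup u\in X\}$ and, for $f:X\to\mathcal{C}$, $f|_t(u)=f(t\cup u)$, $f|_t(\iota_{u,v})=f(\iota_{u\cup t,v\cup t})$. Functors $f:X\to\mathcal{C}$, $g:Y\to\mathcal{C}$ ($X\subseteq\mathcal{P}(s)$, $Y\subseteq\mathcal{P}(t)$) are isomorphic if there are an order-preserving bijection $\sigma:s\to t$ with $Y=\{\sigma(u):u\in X\}$ and isomorphisms $h_u:f(u)\to g(\sigma(u))$ natural in $u$. A collection $\mathcal{A}$ of functors $f:X\to\mathcal{C}$ ($X$ nonempty downward closed in some $\mathcal{P}(s)$, $s\subseteq\omega$ finite) is amenable if: (1) it is closed under isomorphism; (2) $f:X\to\mathcal{C}$ is in $\mathcal{A}$ iff $f\restriction\mathcal{P}(u)\in\mathcal{A}$ for all $u\in X$; (3) $f\in\mathcal{A}$, $t\in X$ imply $f|_t\in\mathcal{A}$; (4)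 if $f:X\to\mathcal{C}$ is in $\mathcal{A}$, $t\in X\subseteq\mathcal{P}(s)$, $X|_t=X\cap\mathcal{P}(s\setminus t)$, and $f|_t$ extends to some $g:Z\to\mathcal{C}$ in $\mathcal{A}$ with $Z\subseteq\mathcal{P}(s\setminus t)$, then there is $g_0:Z_0\to\mathcal{C}$ in $\mathcal{A}$ with $Z_0=\{u\cup v:u\in Z,v\subseteq t\}$, $f\subseteq g_0$, $g_0|_t=g$. An $n$-simplex is a functor $f:\mathcal{P}(s)\to\mathcal{C}$ with $|s|=n+1$; $\operatorname{supp}(f)=s$. $[n]=\{0,\dots,n\}$, $\mathcal{P}^-(s)=\mathcal{P}(s)\setminus\{s\}$. $\mathcal{A}$ has $k$-amalgamation if every $f:\mathcal{P}^-([k-1])\to\mathcal{C}$ in $\mathcal{A}$ extends to a $(k-1)$-simplex in $\mathcal{A}$; $m$-complete amalgamation means $k$-amalgamation for all $1\le k\le m$; strong $2$-amalgamation means any two simplices $f:\mathcal{P}(s)\to\mathcal{C}$, $g:\mathcal{P}(t)\to\mathcal{C}$ in $\mathcal{A}$ agreeing on $\mathcal{P}(s\cap t)$ have $f\cup g$ extending to a simplex on $\mathcal{P}(s\cup t)$ in $\mathcal{A}$; non-trivial means nonempty with $1$-amalgamation and strong $2$-amalgamation. Simplices ''over $B$'' are those with $f(\emptyset)=B$; $C_n(\mathcal{A};B)$ is the free abelian group on $n$-simplices in $\mathcal{A}$ over $B$; for $s=\{s_0<\dots<s_n\}$, $\partial^if=f\restriction\mathcal{P}(s\setminus\{s_i\})$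 and $\partial=\sum_i(-1)^i\partial^i$; $H_n(\mathcal{A};B)=\ker\partial_n/\operatorname{im}\partial_{n+1}$, $[c]$ the class of $c$. The support of a chain is the union of supports of simplices with nonzero coefficient. An $n$-shell is a chain $\pm\sum_{i=0}^{n+1}(-1)^if_i$ of $n$-simplices with $\partial^if_j=\partial^{j-1}f_i$ for $0\le i<j\le n+1$.
   Formalization: The formal theorem assumes that some functor f in A has f(∅) = B; for any other B there are no simplices over B, so H_n(A;B) = {[0]} while there is no n-shell over B, and the stated equality fails. *)

(* Defs.v *)
From mathcomp Require Import all_boot all_order all_algebra finmap.
From mathcomp Require Import boolp classical_sets.
From mathcomp Require Import freeg.

Set Implicit Arguments.
Unset Strict Implicit.
Unset Printing Implicit Defensive.

Import GRing.Theory.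
Local Open Scope fset_scope.

Record category := Category {
  Ob :> Type;
  hom : Ob -> Ob -> Type;
  idm : forall a, hom a a;
  hcomp : forall a b c, hom b c -> hom a b -> hom a c;
  hcomp_idl : forall a b (f : hom a b), hcomp (idm b) f = f;
  hcomp_idr : forall a b (f : hom a b), hcomp f (idm a) = f;
  hcomp_assoc : forall a b c d (h : hom c d) (g : hom b c) (f : hom a b),
    hcomp h (hcomp g f) = hcomp (hcomp h g) f }.

Definition is_iso (C : category) (a b : C) (f : hom a b) : Prop :=
  exists g : hom b a, hcomp g f = idm a /\ hcomp f g = idm b.

(* A functor X -> C on a full subcategory X of some P(s).  The domain X is part
   of the data, the ambient finite set s is not.  Inclusion of finite sets is
   boolean, so that there is exactly one arrow u -> v when u is included in v.
   Leibniz equality of functors is equality of domains, objects and arrows. *)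
Record functor (C : category) := Functor {
  fdom : {fset {fset nat}};
  fob : fdom -> C;
  farr : forall u v : fdom, val u `<=` val v -> hom (fob u) (fob v);
  farr_id : forall (u : fdom) (uu : val u `<=` val u), farr uu = idm (fob u);
  farr_comp : forall (u v w : fdom) (uv : val u `<=` val v)
      (vw : val v `<=` val w) (uw : val u `<=` val w),
    farr uw = hcomp (farr vw) (farr uv) }.

Definition down_closed (X : {fset {fset nat}}) : Prop :=
  forall u v, u `<=` v -> v \in X -> u \in X.

Section Functors.
Context (C : category).
Implicit Types (f g : functor C) (X Y : {fset {fset nat}}) (s t : {fset nat}).

Definition pull f Y (phi : Y -> fdom f)
    (mono : forall u v : Y, val u `<=` val v -> val (phi u) `<=` val (phi v)) :
  functor C :=
  {| fdom := Y;
     fob := fun u => fob (phi u);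
     farr := fun u v uv => farr (mono u v uv);
     farr_id := fun u uu => farr_id (mono u u uu);
     farr_comp := fun u v w uv vw uw =>
       farr_comp (mono u v uv) (mono v w vw) (mono u w uw) |}.

Lemma fincl_mono X Y (XY : X `<=` Y) (u v : X) :
  val u `<=` val v -> val (fincl XY u) `<=` val (fincl XY v).
Proof. by []. Qed.

(* The restriction of f to (fdom f) `&` Y. *)
Definition restr f Y : functor C :=
  pull (fincl_mono (fsubsetIl (fdom f) Y)).

(* f is a restriction of g; the equation forces fdom f `<=` fdom g. *)
Definition extends f g : Prop := restr g (fdom f) = f.

(* X|_t, for X `<=` fpowerset s. *)
Definition link s t X : {fset {fset nat}} :=
  [fset u in fpowerset (s `\` t) | t `|` u \in X].

Lemma linkP s t X (u : link s t X) : t `|` val u \in X.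
Proof. by case: u => u /=; rewrite !inE => /andP[]. Qed.

Definition link_incl s t X (u : link s t X) : X := [` linkP u].

Lemma link_mono s t X (u v : link s t X) :
  val u `<=` val v -> val (link_incl u) `<=` val (link_incl v).
Proof. exact: fsetUS. Qed.

(* f|_t, for fdom f `<=` fpowerset s. *)
Definition loc s t f : functor C := pull (@link_mono s t (fdom f)).

Definition isomorphic f g : Prop :=
  exists (s t : {fset nat}) (sigma : nat -> nat),
  [/\ fdom f `<=` fpowerset s, fdom g `<=` fpowerset t,
      {in s &, {homo sigma : x y / (x < y)%N}},
      t = sigma @` s
    & fdom g = [fset sigma @` (u : {fset nat}) | u in fdom f]]
  /\ exists tau : fdom f -> fdom g,
     (forall u, val (tau u) = sigma @` val u) /\
     exists h : forall u, hom (fob u) (fob (tau u)),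
     (forall u, is_iso (h u)) /\
     (forall u v (uv : val u `<=` val v) (suv : val (tau u) `<=` val (tau v)),
        hcomp (farr suv) (h u) = hcomp (h v) (farr uv)).

Record amenable (A : set (functor C)) : Prop := Amenable {
  amenable_dom : forall f, A f -> fdom f != fset0 /\ down_closed (fdom f);
  amenable_iso : forall f g, isomorphic f g -> A f -> A g;
  amenable_local : forall f, fdom f != fset0 -> down_closed (fdom f) ->
    (A f <-> forall u, u \in fdom f -> A (restr f (fpowerset u)));
  amenable_loc : forall s t f, A f -> fdom f `<=` fpowerset s ->
    t \in fdom f -> A (loc s t f);
  amenable_ext : forall s t f g, A f -> fdom f `<=` fpowerset s ->
    t \in fdom f -> link s t (fdom f) = fdom f `&` fpowerset (s `\` t) ->
    A g -> fdom g `<=` fpowerset (s `\` t) -> extends (loc s t f) g ->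
    exists g0, [/\ A g0,
      fdom g0 = [fset (u : {fset nat}) `|` v | u in fdom g, v in fpowerset t],
      extends f g0 & loc s t g0 = g] }.

Definition simplex n f : Prop :=
  exists s : {fset nat}, #|` s| = n.+1 /\ fdom f = fpowerset s.

(* This is s when fdom f = fpowerset s. *)
Definition supp f : {fset nat} := fcover (fdom f).

(* [n] = {0, ..., n} *)
Definition brack n : {fset nat} := [fset i | i in iota 0 n.+1].

Definition amalgamation (A : set (functor C)) k : Prop :=
  forall f, A f -> fdom f = fpowerset (brack k.-1) `\ brack k.-1 ->
  exists g, [/\ A g, simplex k.-1 g & extends f g].

Definition complete_amalgamation (A : set (functor C)) m : Prop :=
  forall k, (1 <= k <= m)%N -> amalgamation A k.

Definition strong_2_amalgamation (A : set (functor C)) : Prop :=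
  forall s t f g, A f -> A g -> fdom f = fpowerset s -> fdom g = fpowerset t ->
  restr f (fpowerset (s `&` t)) = restr g (fpowerset (s `&` t)) ->
  exists h, [/\ A h, fdom h = fpowerset (s `|` t), extends f h & extends g h].

Definition nontrivial (A : set (functor C)) : Prop :=
  [/\ exists f, A f, amalgamation A 1 & strong_2_amalgamation A].

Definition over_base (B : C) f : Prop :=
  exists B0 : fset0 \in fdom f, fob [` B0] = B.

Definition simplex_over (A : set (functor C)) (B : C) n f : Prop :=
  [/\ A f, simplex n f & over_base B f].

Definition face i f : functor C :=
  restr f (fpowerset (supp f `\ nth 0%N (sort leq (supp f)) i)).

End Functors.

(* All chain groups C_n(A; B) are subgroups of the free abelian group on all
   functors; {classic _} provides the choiceType structure. *)
Notation chain C := {freeg {classic (functor C)}}.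

Definition basis (C : category) (f : functor C) : chain C :=
  << (f : {classic (functor C)}) >>.

Section Homology.
Context (C : category) (A : set (functor C)) (B : C) (n : nat).
Local Open Scope ring_scope.

Definition chains (c : chain C) : Prop :=
  forall f : functor C, f \in dom c -> simplex_over A B n f.

(* The differential on chains of n-simplices, n >= 1. *)
Definition bd (c : chain C) : chain C :=
  fglift (fun f : {classic (functor C)} =>
    \sum_(i < n.+1) (-1) ^+ i *: basis (face i f)) c.

Definition cycles (c : chain C) : Prop := chains c /\ bd c = 0.

Definition chain_supp (c : chain C) : {fset nat} :=
  \bigcup_(f <- dom c) supp (f : functor C).

Definition shell (c : chain C) : Prop :=
  exists f : 'I_n.+2 -> functor C,
  let S : chain C := \sum_(i < n.+2) (-1) ^+ i *: basis (f i) in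
  [/\ forall i, simplex_over A B n (f i),
      forall i j : 'I_n.+2, (i < j)%N -> face i (f j) = face j.-1 (f i)
    & c = S \/ c = - S].

End Homology.

Section HomologyGroup.
Context (C : category) (A : set (functor C)) (B : C) (n : nat).
Local Open Scope ring_scope.
Local Open Scope classical_set_scope.

Definition boundaries : set (chain C) :=
  [set bd n.+1 e | e in chains A B n.+1].

Definition hclass (c : chain C) : set (chain C) := [set c + b | b in boundaries].

(* The underlying set of the quotient group H_n(A; B), for n >= 1, as the set of
   cosets of the boundaries. *)
Definition homology : set (set (chain C)) :=
  [set hclass c | c in cycles A B n].

End HomologyGroup.

(* Main.v *)
(* Call a functor of A over B on P^-(T), with |T| = n + 2, a shell on T.  The
   fourth amenability axiom turns (n+1)-complete amalgamation into a horn-filling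
   property in dimension n + 1: if |s| = n + 3 and two shells on s \ a and s \ b
   agree on s \ {a,b}, they extend to a functor that contains all sets of size
   n + 1 and all faces s \ x except x = a, b, c, where c may be chosen.  Hence
   some signed sum of the two shells and of a shell on s \ c is a boundary.  If
   the shell on s \ b is chosen to be filled, this moves a shell from s \ a to
   s \ c, and so to any other support, up to a sign that depends on the supports
   only; moving around a 3-cycle shows that the negative of a shell is homologous
   to a shell with the same support.  By strong 2-amalgamation a shell can be
   moved onto a prescribed n-simplex, so any two shells can be made to share a
   face and be added.  Finally, (n+1)-complete amalgamation allows one to cone off
   all simplices of dimension < n compatibly from a new vertex; coning off a cycle
   writes it, up to sign, as a sum of shells. *)
From HB Require Import structures.
Require Import Defs.
From mathcomp Require Import all_boot ssralg ssrnum ssrint finmap.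
From mathcomp Require Import boolp classical_sets.
From mathcomp Require Import freeg zify ring.

Set Implicit Arguments.
Unset Strict Implicit.
Unset Printing Implicit Defensive.

Import GRing.Theory.
Local Open Scope fset_scope.

(** * Functors as tables of arrows *)

Section Arrows.
Context (C : category).
Implicit Types (f g : functor C) (X Y : {fset {fset nat}}).
Implicit Types (s t u v w : {fset nat}).

Record arrow := Arrow { src : C; tgt : C; arr : hom src tgt }.

Definition cast_arr (m : arrow) a b (ea : src m = a) (eb : tgt m = b) :
    hom a b :=
  match ea in _ = a, eb in _ = b return hom a b with
  | erefl, erefl => arr m
  end.

(** Equal packed arrows have equal casts along any endpoint equations, since proofs of such
    equations are irrelevant; along [erefl] the cast returns the arrow itself. *)
Lemma Arrow_inj a b : injective (@Arrow a b).
Proof.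
suff cast_eq m m' (ea : src m = a) (eb : tgt m = b) (ea' : src m' = a)
    (eb' : tgt m' = b) : m = m' -> cast_arr ea eb = cast_arr ea' eb'.
  by move=> h h'; exact: (cast_eq (Arrow h) (Arrow h') erefl erefl erefl erefl).
move=> mm'; case: m' / mm' ea' eb' => ea' eb'.
by rewrite (Prop_irrelevance ea ea') (Prop_irrelevance eb eb').
Qed.

Lemma arrowE (m : arrow) a b :
  src m = a -> tgt m = b -> exists h : hom a b, m = Arrow h.
Proof. by case: m => a' b' h /= <- <-; exists h. Qed.

(* All arrows of a functor as a table indexed by plain sets: unlike [fob] and
   [farr], two tables can be compared without transporting along equalities of
   domains and objects. *)
Definition ar f u v : option arrow :=
  match pselect (u \in fdom f), pselect (v \in fdom f), pselect (u `<=` v) with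
  | left hu, left hv, left uv =>
      Some (Arrow (@farr C f [` hu] [` hv] uv))
  | _, _, _ => None
  end.

Lemma ar_val f (u v : fdom f) (uv : val u `<=` val v) :
  ar f (val u) (val v) = Some (Arrow (farr uv)).
Proof.
case: u v uv => u hu [v hv] /= uv; rewrite /ar.
case: pselect => [hu'|/(_ hu)//]; case: pselect => [hv'|/(_ hv)//].
case: pselect => [uv'|/(_ uv)//].
rewrite (bool_irrelevance hu' hu) (bool_irrelevance hv' hv).
by rewrite (bool_irrelevance uv' uv).
Qed.

Lemma ar_some f u v :
  isSome (ar f u v) = [&& u \in fdom f, v \in fdom f & u `<=` v].
Proof.
rewrite /ar; case: pselect => [hu|/negP/negPf->] //.
case: pselect => [hv|/negP/negPf->]; last by rewrite andbF.
case: pselect => [uv|/negP/negPf->]; last by rewrite !andbF.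
by rewrite hu hv uv.
Qed.

Lemma ar_none f u v :
  ~~ [&& u \in fdom f, v \in fdom f & u `<=` v] -> ar f u v = None.
Proof. by rewrite -ar_some; case: ar. Qed.

(** Diagonal entries determine the domain, sources the objects, and [Arrow_inj] the arrows; the laws
    are propositions. Equalities of functors thus become comparisons of tables. *)
Lemma ar_ext f g : (forall u v, ar f u v = ar g u v) -> f = g.
Proof.
move=> fg; have domE : fdom f = fdom g.
  by apply/fsetP => u; have := ar_some g u u;
    rewrite -fg ar_some fsubset_refl !andbT !andbb.
case: f g domE fg => X ob1 m1 i1 c1 [Y ob2 m2 i2 c2] /= XY; subst Y.
set f := Functor i1 c1; set g := Functor i2 c2 => fg.
have arfg (u v : X) (uv : val u `<=` val v) :
    Arrow (m1 u v uv) = Arrow (m2 u v uv).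
  have := fg (val u) (val v); rewrite (@ar_val f u v uv) (@ar_val g u v uv).
  exact: Some_inj.
have obE : ob1 = ob2.
  by apply/funext => u; have := congr1 src (arfg u u (fsubset_refl _)).
rewrite {}/f {}/g in fg *; subst ob2.
have mE : m1 = m2.
  apply: functional_extensionality_dep => u; apply: functional_extensionality_dep => v.
  by apply: functional_extensionality_dep => uv; apply: Arrow_inj.
by subst m2; congr Functor; apply: Prop_irrelevance.
Qed.

(** The functor laws for a table. Endpoints are existentially quantified, so that no assignment of
    objects has to be supplied. *)
Definition coherent X (M : {fset nat} -> {fset nat} -> option arrow) : Prop :=
  (forall u, u \in X -> exists a, M u u = Some (Arrow (idm a))) /\
  (forall u v w, u \in X -> v \in X -> w \in X -> u `<=` v -> v `<=` w ->
     exists a b c (h : hom a b) (k : hom b c),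
       [/\ M u v = Some (Arrow h), M v w = Some (Arrow k)
         & M u w = Some (Arrow (hcomp k h))]).

Lemma ar_coherent f : coherent (fdom f) (ar f).
Proof.
split=> [u hu|u v w hu hv hw uv vw].
  have uu : val [` hu] `<=` val [` hu] by apply: fsubset_refl.
  by exists (fob [` hu]); rewrite (ar_val uu) farr_id.
have uw := fsubset_trans uv vw.
exists (fob [` hu]), (fob [` hv]), (fob [` hw]).
exists (@farr C f [` hu] [` hv] uv), (@farr C f [` hv] [` hw] vw).
rewrite (@ar_val f [` hu] [` hv] uv) (@ar_val f [` hv] [` hw] vw).
by rewrite (@ar_val f [` hu] [` hw] uw) (@farr_comp C f [` hu] [` hv] [` hw] uv vw uw).
Qed.

(** Objects are read off the identity entries. Composing with the identity entry at [u],
    respectively [v], forces source and target of [M u v] to be the chosen objects. *)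
Lemma coherent_functor X M : coherent X M ->
  exists f, fdom f = X /\
    (forall u v, u \in X -> v \in X -> u `<=` v -> ar f u v = M u v).
Proof.
move=> [M1 M2].
have [|ob obE] := @choice X C
    (fun (u : X) a => M (val u) (val u) = Some (Arrow (idm a))).
  by move=> u; apply: M1 (valP u).
have mex (u v : X) (uv : val u `<=` val v) :
    exists h : hom (ob u) (ob v), M (val u) (val v) = Some (Arrow h).
  have [a [b [c [h [k [+ hk _]]]]]] :=
    M2 _ _ _ (valP u) (valP u) (valP v) (fsubset_refl _) uv.
  have [a' [b' [c' [h' [k' [hh' + _]]]]]] :=
    M2 _ _ _ (valP u) (valP v) (valP v) uv (fsubset_refl _).
  rewrite !obE => /Some_inj/(congr1 src)/= vb /Some_inj/(congr1 tgt)/= ub.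
  move: hh'; rewrite hk => /Some_inj/(congr1 tgt)/= cb.
  have [|//|h1 hE] := @arrowE (Arrow k) (ob u) (ob v); last by exists h1; rewrite -hE.
    by rewrite ub.
  by rewrite /= cb vb.
pose m (u v : X) uv := sval (cid (mex u v uv)).
have mE (u v : X) uv : M (val u) (val v) = Some (Arrow (m u v uv)).
  exact: svalP (cid (mex u v uv)).
have mid (u : X) (uu : val u `<=` val u) : m u u uu = idm (ob u).
  by apply: Arrow_inj; have := mE u u uu; rewrite obE => /Some_inj.
have mcomp (u v w : X) (uv : val u `<=` val v) (vw : val v `<=` val w)
    (uw : val u `<=` val w) : m u w uw = hcomp (m v w vw) (m u v uv).
  have [a [b [c [h [k []]]]]] :=
    M2 _ _ _ (valP u) (valP v) (valP w) uv vw.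
  rewrite (mE u v uv) (mE v w vw) (mE u w uw) => /Some_inj huv /Some_inj hvw.
  have [[ea eb] ec] := (congr1 src huv, congr1 tgt huv, congr1 tgt hvw).
  rewrite /= in ea eb ec; subst a b c; move: huv hvw.
  by move=> /Arrow_inj <- /Arrow_inj <- /Some_inj/Arrow_inj.
exists (Functor mid mcomp); split=> // u v hu hv uv.
by rewrite (@ar_val (Functor mid mcomp) [` hu] [` hv] uv) (mE [` hu] [` hv] uv).
Qed.

Lemma ar_pull f Y (phi : Y -> fdom f)
    (mono : forall u v : Y, val u `<=` val v -> val (phi u) `<=` val (phi v))
    (u v : Y) : val u `<=` val v ->
  ar (pull mono) (val u) (val v) = ar f (val (phi u)) (val (phi v)).
Proof. by move=> uv; rewrite (@ar_val (pull mono) u v uv) (ar_val (mono _ _ uv)). Qed.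

Lemma ar_restr f Y u v :
  ar (restr f Y) u v = if (u \in Y) && (v \in Y) then ar f u v else None.
Proof.
have [/and3P[hu hv uv]|n] := boolP [&& u \in fdom f `&` Y, v \in fdom f `&` Y & u `<=` v].
  have -> := @ar_pull f _ _ (fincl_mono (fsubsetIl (fdom f) Y)) [` hu] [` hv] uv.
  have [/fsetIP[_ uY] /fsetIP[_ vY]] := (hu, hv).
  by rewrite uY vY.
rewrite ar_none //; case: ifP => // /andP[uY vY]; rewrite ar_none //.
by move: n; rewrite !inE uY vY !andbT.
Qed.

Lemma restr_eqP f g X :
  restr f X = restr g X <->
  (forall u v, u \in X -> v \in X -> ar f u v = ar g u v).
Proof.
split=> [E u v uX vX|E]; last first.
  by apply: ar_ext => u v; rewrite !ar_restr; case: ifP => // /andP[]; apply: E.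
by have := congr1 (fun h => ar h u v) E; rewrite !ar_restr uX vX.
Qed.

Lemma restr_restr f X Y : Y `<=` X -> restr (restr f X) Y = restr f Y.
Proof.
move=> /fsubsetP YX; apply: ar_ext => u v; rewrite !ar_restr.
by case: ifP => // /andP[/YX -> /YX ->].
Qed.

Lemma restr_id f X : fdom f `<=` X -> restr f X = f.
Proof.
move=> /fsubsetP fX; apply: ar_ext => u v; rewrite ar_restr.
case: ifP => // /negP n; rewrite ar_none //.
by apply/negP => /and3P[/fX uX /fX vX _]; apply: n; rewrite uX vX.
Qed.

Lemma restr_eqS f g X Y : Y `<=` X ->
  restr f X = restr g X -> restr f Y = restr g Y.
Proof. by move=> YX E; rewrite -(restr_restr f YX) E restr_restr. Qed.

Lemma fdom_ar f u : (u \in fdom f) = isSome (ar f u u).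
Proof. by rewrite ar_some fsubset_refl andbT andbb. Qed.

(** The entry at (u, v) is taken from [H v]. For a composable pair ending at [w], all three entries
    can be read in [H w], where the laws already hold. *)
Lemma glue_family X (H : {fset nat} -> functor C) : down_closed X ->
  (forall u, u \in X -> fdom (H u) = fpowerset u) ->
  (forall u v, v \in X -> u `<=` v -> restr (H v) (fpowerset u) = H u) ->
  exists F, fdom F = X /\ forall u, u \in X -> restr F (fpowerset u) = H u.
Proof.
move=> dX domH HH.
have arH u v w w' : w \in X -> w' `<=` w -> v `<=` w' ->
    u `<=` v -> ar (H w) u v = ar (H w') u v.
  move=> wX w'w vw' uv; rewrite -(HH w' w) // ar_restr !fpowersetE.
  by rewrite vw' (fsubset_trans uv vw').
have [|F [domF arF]] := @coherent_functor X (fun u v => ar (H v) u v).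
  split=> [u uX|u v w uX vX wX uv vw].
    have [+ _] := ar_coherent (H u); move=> /(_ u); apply.
    by rewrite domH // fpowersetE fsubset_refl.
  have [_] := ar_coherent (H w); move=> /(_ u v w); rewrite domH // !fpowersetE.
  rewrite (arH u v w v) //; apply=> //; exact: fsubset_trans vw.
exists F; split=> // u uX; apply: ar_ext => v w.
rewrite ar_restr !fpowersetE; case: ifP => [/andP[vu wu]|n].
  have vX := dX _ _ vu uX; have wX := dX _ _ wu uX.
  have [vw|vw] := boolP (v `<=` w); first by rewrite arF // (arH v w u w).
  by rewrite !ar_none // (negPf vw) !andbF.
by rewrite ar_none // domH // !fpowersetE andbA n.
Qed.

End Arrows.

(** * Transport along order isomorphisms, restriction and gluing *)

Section OrderIsomorphisms.
Implicit Types (s t u v : {fset nat}).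

(** The increasing bijection from [s] to [t] when both have the same size; points outside [s] then
    go to the default 0. *)
Definition ord_iso s t (x : nat) : nat :=
  nth 0%N (sort leq t) (index x (sort leq s)).

Lemma size_sort_fset s : size (sort leq s) = #|` s|.
Proof. by rewrite size_sort. Qed.

Lemma sort_fset_uniq s : uniq (sort leq s).
Proof. by rewrite sort_uniq fset_uniq. Qed.

Lemma sort_fset_sorted s : sorted ltn (sort leq s).
Proof.
by rewrite ltn_sorted_uniq_leq sort_fset_uniq sort_sorted //; apply: leq_total.
Qed.

Lemma ord_iso_index s t x : #|` s| = #|` t| -> x \in s ->
  (index x (sort leq s) < size (sort leq t))%N.
Proof.
by move=> st xs; rewrite size_sort_fset -st -size_sort_fset index_mem mem_sort.
Qed.

Lemma ord_iso_in s t x : #|` s| = #|` t| -> x \in s -> ord_iso s t x \in t.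
Proof. by move=> st xs; rewrite -(mem_sort leq) mem_nth // ord_iso_index. Qed.

Lemma ord_isoK s t x : #|` s| = #|` t| -> x \in s ->
  ord_iso t s (ord_iso s t x) = x.
Proof.
move=> st xs; rewrite {1}/ord_iso index_uniq ?sort_fset_uniq ?ord_iso_index //.
by rewrite nth_index // mem_sort.
Qed.

Lemma ord_iso_mono s t : #|` s| = #|` t| ->
  {in s &, {homo ord_iso s t : x y / (x < y)%N}}.
Proof.
move=> st x y xs ys xy.
have idx_mono : (index x (sort leq s) < index y (sort leq s))%N.
  rewrite ltnNge; apply/negP => yx.
  have := sorted_leq_nth leq_trans leqnn 0%N (sort_sorted leq_total s).
  move=> /(_ (index y (sort leq s)) (index x (sort leq s))).
  rewrite !inE !index_mem !mem_sort xs ys yx => /(_ isT isT isT).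
  by rewrite !nth_index ?mem_sort // leqNgt xy.
have := sorted_ltn_nth ltn_trans 0%N (sort_fset_sorted t).
by move=> /(_ _ _ _ _ idx_mono); apply; rewrite inE ord_iso_index.
Qed.

Lemma ord_iso_sub s t u : #|` s| = #|` t| -> u `<=` s ->
  ord_iso s t @` u `<=` t.
Proof.
move=> st /fsubsetP us; apply/fsubsetP => _ /imfsetP[x /= xu ->].
exact: ord_iso_in (us _ xu).
Qed.

Lemma ord_iso_imK s t u : #|` s| = #|` t| -> u `<=` s ->
  ord_iso t s @` (ord_iso s t @` u) = u.
Proof.
move=> st /fsubsetP us; apply/fsetP => x; apply/imfsetP/idP => [|xu].
  by case=> _ /= /imfsetP[y /= yu ->] ->; rewrite ord_isoK // us.
exists (ord_iso s t x); first by apply/imfsetP; exists x.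
by rewrite ord_isoK // us.
Qed.

Lemma imfsetS (h : nat -> nat) u v : u `<=` v -> h @` u `<=` h @` v.
Proof. by move=> /fsubsetP uv; apply: subset_imfset. Qed.

Lemma ord_iso_im s t : #|` s| = #|` t| -> ord_iso s t @` s = t.
Proof.
move=> st; apply/eqP; rewrite eqEfsubset ord_iso_sub //=.
rewrite -{1}(@ord_iso_imK t s t) // imfsetS // ord_iso_sub //.
Qed.

Lemma ord_iso_image s t (X : {fset {fset nat}}) y : #|` s| = #|` t| ->
  X `<=` fpowerset s ->
  (y \in [fset ord_iso s t @` (u : {fset nat}) | u in X]) =
  (y `<=` t) && (ord_iso t s @` y \in X).
Proof.
move=> st /fsubsetP Xs; apply/imfsetP/andP => [[u /= uX ->]|[yt yX]].
  have us : u `<=` s by rewrite -fpowersetE Xs.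
  by rewrite ord_iso_sub // ord_iso_imK.
by exists (ord_iso t s @` y) => //; rewrite ord_iso_imK.
Qed.

(** Amalgamation is stated for standard supports only; relabelling carries it to others. The new
    functor is the pullback along the inverse relabelling, so its entries are literally those of
    [f]. *)
Lemma reindex_along (C : category) s t (f : functor C) :
  #|` s| = #|` t| -> fdom f `<=` fpowerset s ->
  exists g : functor C, [/\ isomorphic f g,
    fdom g = [fset ord_iso s t @` (u : {fset nat}) | u in fdom f]
    & forall u v, u \in fdom f -> v \in fdom f -> u `<=` v ->
        ar g (ord_iso s t @` u) (ord_iso s t @` v) = ar f u v].
Proof.
move=> st fs; have subs u : u \in fdom f -> u `<=` s.
  by move=> uf; rewrite -fpowersetE (fsubsetP fs).
pose Y := [fset ord_iso s t @` (u : {fset nat}) | u in fdom f].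
have YP (y : Y) : ord_iso t s @` val y \in fdom f.
  by have := valP y; rewrite (ord_iso_image _ st fs) => /andP[].
pose phi (y : Y) : fdom f := [` YP y].
have mono (y z : Y) : val y `<=` val z -> val (phi y) `<=` val (phi z).
  exact: imfsetS.
have Yin u : u \in fdom f -> ord_iso s t @` u \in Y.
  by move=> uf; apply/imfsetP; exists u.
exists (pull mono); split=> //; last first.
  move=> u v uf vf uv.
  rewrite (@ar_pull _ _ _ _ mono [` Yin u uf] [` Yin v vf]) ?imfsetS //=.
  by rewrite !ord_iso_imK ?subs.
exists s, t, (ord_iso s t); split.
  split=> //; [| exact: ord_iso_mono | by rewrite ord_iso_im].
  apply/fsubsetP => y; rewrite (ord_iso_image _ st fs) fpowersetE.
  by case/andP.
exists (fun u : fdom f => [` Yin _ (valP u)]); split=> //.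
(* The components of the isomorphism are the arrows of f between u and the
   equal set phi (tau u), which avoids a cast. *)
pose tau (u : fdom f) : Y := [` Yin _ (valP u)].
have le1 (u : fdom f) : val u `<=` val (phi (tau u)).
  by rewrite /= ord_iso_imK ?subs ?(valP u).
have le2 (u : fdom f) : val (phi (tau u)) `<=` val u.
  by rewrite /= ord_iso_imK ?subs ?(valP u).
exists (fun u : fdom f => farr (le1 u)); split=> [u|u v uv suv].
  exists (farr (le2 u)); split.
    by rewrite -(farr_comp (le1 u) (le2 u) (fsubset_refl _)) farr_id.
  by rewrite -(farr_comp (le2 u) (le1 u) (fsubset_refl _)) farr_id.
have uv' : val u `<=` val (phi (tau v)) := fsubset_trans uv (le1 v).
by rewrite -(farr_comp uv (le1 v) uv') -(farr_comp (le1 u) (mono _ _ suv) uv').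
Qed.

End OrderIsomorphisms.

Lemma down_closedI (X Y : {fset {fset nat}}) :
  down_closed X -> down_closed Y -> down_closed (X `&` Y).
Proof.
by move=> dX dY u v uv; rewrite !inE => /andP[vX vY]; rewrite (dX u v) // (dY u v).
Qed.

Lemma down_closedU (X Y : {fset {fset nat}}) :
  down_closed X -> down_closed Y -> down_closed (X `|` Y).
Proof.
move=> dX dY u v uv; rewrite !inE => /orP[vX|vY].
  by rewrite (dX u v).
by rewrite (dY u v) ?orbT.
Qed.

Lemma down_closed_fpowerset (s : {fset nat}) : down_closed (fpowerset s).
Proof. by move=> u v uv; rewrite !fpowersetE; apply: fsubset_trans. Qed.

(* The paper's P^-(s). *)
Definition fboundary (s : {fset nat}) : {fset {fset nat}} :=
  fpowerset s `\ s.

Lemma in_fboundary s u : (u \in fboundary s) = (u `<` s).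
Proof. by rewrite !inE fpowersetE fproperEneq. Qed.

Lemma down_closed_fboundary s : down_closed (fboundary s).
Proof. by move=> u v uv; rewrite !in_fboundary; apply: fsub_proper_trans. Qed.

Lemma fset0_down_closed X : X != fset0 -> down_closed X -> fset0 \in X.
Proof. by case/fset0Pn => u uX /(_ fset0 u (fsub0set _) uX). Qed.

(** * Restriction and gluing inside an amenable family *)

Section Amenable.
Context (C : category) (A : set (functor C)) (hA : amenable A).
Implicit Types (f g : functor C) (X Y : {fset {fset nat}}).
Implicit Types (s t u v w : {fset nat}).

Lemma A_fset0 f : A f -> fset0 \in fdom f.
Proof. by case/(amenable_dom hA) => + +; apply: fset0_down_closed. Qed.

Lemma A_down f : A f -> down_closed (fdom f).
Proof. by case/(amenable_dom hA). Qed.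

Lemma fpowerset_sub X u : down_closed X -> u \in X -> fpowerset u `<=` X.
Proof. by move=> dX uX; apply/fsubsetP => v; rewrite fpowersetE => /dX; apply. Qed.

(** Locality is used in both directions: it reduces the claim to restrictions to full power sets,
    and it provides these from [f]. *)
Lemma restr_in f Y : A f -> fset0 \in Y -> down_closed Y -> A (restr f Y).
Proof.
move=> Af Y0 dY; have dfY := down_closedI (A_down Af) dY.
have fY0 : fset0 \in fdom (restr f Y) by rewrite !inE A_fset0.
apply/(amenable_local hA) => // [|u /fsetIP[uf uY]].
  by apply/fset0Pn; exists fset0.
rewrite restr_restr ?fpowerset_sub //.
by apply: (amenable_local hA _ _).1 => //; [case: (amenable_dom hA Af)|exact: A_down].
Qed.

Lemma restr_fpowerset_in f u : A f -> A (restr f (fpowerset u)).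
Proof.
move=> Af; apply: restr_in => //; last exact: down_closed_fpowerset.
by rewrite fpowersetE fsub0set.
Qed.

Lemma restr_fpowerset_dom f u : A f -> u \in fdom f ->
  fdom (restr f (fpowerset u)) = fpowerset u.
Proof. by move=> Af uf; apply/fsetIidPr/fpowerset_sub => //; apply: A_down. Qed.

Lemma glue_family_in X (H : {fset nat} -> functor C) :
  X != fset0 -> down_closed X -> (forall u, u \in X -> A (H u)) ->
  (forall u, u \in X -> fdom (H u) = fpowerset u) ->
  (forall u v, v \in X -> u `<=` v -> restr (H v) (fpowerset u) = H u) ->
  exists F, [/\ A F, fdom F = X & forall u, u \in X -> restr F (fpowerset u) = H u].
Proof.
move=> X0 dX AH domH HH; have [F [FX FH]] := glue_family dX domH HH.
exists F; split=> //; apply/(amenable_local hA); rewrite ?FX // => u uX.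
by rewrite FH //; apply: AH.
Qed.

(** The piece on [fpowerset u] comes from [f] if [u] lies in its domain and from [g] otherwise.
    Agreement on the intersection makes the pieces compatible, and locality puts the result in
    [A]. *)
Lemma glue2 f g : A f -> A g ->
  restr f (fdom f `&` fdom g) = restr g (fdom f `&` fdom g) ->
  exists h, [/\ A h, fdom h = fdom f `|` fdom g, restr h (fdom f) = f
    & restr h (fdom g) = g].
Proof.
move=> Af Ag fg; have [df dg] := (A_down Af, A_down Ag).
pose H u := if u \in fdom f then restr f (fpowerset u) else restr g (fpowerset u).
have [||||u v|h [Ah hd hH]] := @glue_family_in (fdom f `|` fdom g) H.
- by apply/fset0Pn; exists fset0; rewrite inE A_fset0.
- exact: down_closedU.
- by move=> u _; rewrite /H; case: ifP => _; apply: restr_fpowerset_in.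
- move=> u; rewrite inE /H; case: ifP => /= uf ug; exact: restr_fpowerset_dom.
- rewrite inE /H; case: ifP => /= vf vg uv.
    by rewrite (df u v) // restr_restr // fpowersetS.
  rewrite restr_restr ?fpowersetS //; case: ifP => // uf.
  apply/esym; apply: restr_eqS fg; apply: fpowerset_sub; first exact: down_closedI.
  by rewrite inE uf (dg u v).
exists h; split=> //; apply: ar_ext => u v; rewrite ar_restr.
  case: ifP => [/andP[uf vf]|n]; last first.
    by rewrite ar_none // andbA n.
  have [uv|uv] := boolP (u `<=` v); last by rewrite !ar_none // (negPf uv) !andbF.
  have := hH v; rewrite inE /H vf => /(_ isT)/restr_eqP.
  by apply; rewrite fpowersetE ?uv.
case: ifP => [/andP[ug vg]|n]; last first.
  by rewrite ar_none // andbA n.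
have [uv|uv] := boolP (u `<=` v); last by rewrite !ar_none // (negPf uv) !andbF.
have := hH v; rewrite inE vg orbT /H => /(_ isT).
case: ifP => [vf|_] /restr_eqP/(_ u v) ->; rewrite ?fpowersetE ?uv ?fsubset_refl //.
move/restr_eqP: fg => /(_ u v) ->; rewrite ?inE ?vf ?vg ?ug ?andbT //.
exact: df vf.
Qed.

End Amenable.

(** * Filling *)

Lemma in_brack n x : (x \in brack n) = (x <= n)%N.
Proof.
have iotaP y : (y \in iota 0 n.+1) = (y <= n)%N by rewrite mem_iota ltnS.
apply/imfsetP/idP => [[y yn ->]|xn]; first by rewrite -iotaP.
by exists x => //; rewrite -iotaP in xn.
Qed.

Lemma card_brack n : #|` brack n| = n.+1.
Proof.
elim: n => [|n IHn].
  suff -> : brack 0 = [fset 0%N] by rewrite cardfs1.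
  by apply/fsetP => x; rewrite in_brack inE leqn0.
have -> : brack n.+1 = n.+1 |` brack n.
  by apply/fsetP => x; rewrite in_fset1U !in_brack leq_eqVlt ltnS.
by rewrite cardfsU1 in_brack ltnn /= IHn.
Qed.

Lemma fproperP (K : choiceType) (s t : {fset K}) :
  reflect ({subset s <= t} /\ exists2 x, x \in t & x \notin s) (s `<` t).
Proof.
rewrite fproperE; apply: (iffP andP) => -[/fsubsetP st /fsubsetPn ts];
  by split=> //; apply/fsubsetP.
Qed.

Lemma card_fsetD1 (K : choiceType) (s : {fset K}) a :
  a \in s -> #|` s| = (#|` s `\ a|).+1.
Proof. by move=> a_s; rewrite (cardfsD1 a) a_s. Qed.

Lemma ord_iso_fboundary s t : #|` s| = #|` t| ->
  [fset ord_iso s t @` (u : {fset nat}) | u in fboundary s] = fboundary t.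
Proof.
move=> st; apply/fsetP => y; rewrite ord_iso_image //; last exact: fsubsetDl.
rewrite !in_fboundary !fproperEneq.
case: (boolP (y `<=` t)) => yt; rewrite ?andbF //= ord_iso_sub // !andbT.
congr negb; apply/eqP/eqP => [ys|->]; last by rewrite ord_iso_im.
by rewrite -(ord_iso_imK (esym st) yt) ys ord_iso_im.
Qed.

Section Amalgamation.
Context (C : category) (A : set (functor C)) (n : nat).
Context (hA : amenable A) (hCA : complete_amalgamation A n.+1).
Implicit Types (f g : functor C) (X Y : {fset {fset nat}}).
Implicit Types (s t u v w : {fset nat}).

Lemma fill_boundary u f : u != fset0 -> (#|` u| <= n.+1)%N ->
  A f -> fdom f = fboundary u ->
  exists g, [/\ A g, fdom g = fpowerset u & restr g (fboundary u) = f].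
Proof.
rewrite -cardfs_gt0; set k := #|` u| => k_gt0 kn Af fu.
have ub : #|` u| = #|` brack k.-1| by rewrite card_brack prednK.
have fsub : fdom f `<=` fpowerset u by rewrite fu fsubsetDl.
have [f' [ff' f'dom arf']] := reindex_along ub fsub.
rewrite fu ord_iso_fboundary // in f'dom.
have hk : (1 <= k <= n.+1)%N by rewrite k_gt0.
have Af' : A f' by apply: (amenable_iso hA) ff' Af.
have [g' [Ag' [t [tk g'dom]] f'g']] := hCA hk Af' f'dom.
rewrite prednK // in tk.
have g'sub : fdom g' `<=` fpowerset t by rewrite g'dom.
have ut : #|` u| = #|` t| by rewrite tk.
have [g [g'g gdom arg]] := reindex_along (esym ut) g'sub.
(* Amalgamation yields a simplex on an unspecified [t] of size [k]. If [k] is at least 2, the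
   singletons in the boundary force [t] to be the standard set; if [k] is 1, the only proper subset
   is empty and both relabellings fix it. *)
have tb v : v `<` u -> ord_iso u t @` v = ord_iso u (brack k.-1) @` v.
  have [k1|k1] := leqP k 1.
    move=> /fproper_ltn_card; rewrite -/k => vk.
    have -> : v = fset0 by apply/cardfs0_eq; lia.
    by rewrite !imfset0.
  suff -> : t = brack k.-1 by [].
  apply/esym/eqP; rewrite eqEfcard card_brack tk prednK // leqnn andbT.
  apply/fsubsetP => x; rewrite in_brack => xk.
  have : [fset x] \in fdom f'.
    rewrite f'dom in_fboundary fproperEcard fsub1set in_brack xk cardfs1.
    by rewrite card_brack; lia.
  rewrite -f'g' /= inE => /andP[+ _].
  by rewrite g'dom fpowersetE fsub1set.
exists g; split.
- exact: (amenable_iso hA) g'g Ag'.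
- rewrite gdom; apply/fsetP => y; rewrite ord_iso_image // g'dom !fpowersetE.
  by apply: andb_idr => yu; rewrite ord_iso_sub.
apply: ar_ext => v w; rewrite ar_restr !in_fboundary.
case: ifP => [/andP[vu wu]|nvw]; last first.
  by rewrite ar_none // fu !in_fboundary andbA nvw.
have [vw|vw] := boolP (v `<=` w); last by rewrite !ar_none // (negPf vw) !andbF.
have [vs ws] := (fproper_sub vu, fproper_sub wu).
rewrite -[v in LHS](@ord_iso_imK u t) // -[w in LHS](@ord_iso_imK u t) //.
rewrite arg ?g'dom ?fpowersetE ?ord_iso_sub ?imfsetS //.
rewrite -arf' ?fu ?in_fboundary // !tb // -f'g' ar_restr f'dom.
by rewrite -(ord_iso_fboundary ub) !(ord_iso_image _ ub) ?fsubsetDl //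
  ?ord_iso_sub //= !ord_iso_imK // !in_fboundary vu wu.
Qed.

Lemma exists_min_card X : X != fset0 ->
  exists2 u, u \in X & forall v, v \in X -> (#|` u| <= #|` v|)%N.
Proof.
move=> /fset0Pn[u0 u0X].
pose P k := `[< exists2 u, u \in X & #|` u| = k >].
have exP : exists k, P k by exists #|` u0|; apply/asboolP; exists u0.
case: (ex_minnP exP) => k /asboolP[u uX uk] kmin; exists u => // v vX.
by rewrite uk kmin //; apply/asboolP; exists v.
Qed.

(** Missing sets are added one at a time. One of least size has all its proper subsets in the domain
    already, so its boundary can be filled and the filling glued on. *)
Lemma fill_skeleton f Y : A f -> down_closed Y -> fdom f `<=` Y ->
  (forall u, u \in Y -> u \notin fdom f -> (#|` u| <= n.+1)%N) ->
  exists g, [/\ A g, fdom g = Y & restr g (fdom f) = f].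
Proof.
move=> + dY; have [m] := ubnP #|` Y `\` fdom f|.
elim: m f => // m IHm f Ym Af fY cardY.
have [Yf|Yf0] := eqVneq (Y `\` fdom f) fset0.
  exists f; split; rewrite ?restr_id //.
  by apply/eqP; rewrite eqEfsubset fY -fsetD_eq0 Yf eqxx.
have [u] := exists_min_card Yf0; rewrite inE => /andP[uf uY] umin.
have u0 : u != fset0.
  by apply: contraNneq uf => ->; apply: (A_fset0 hA).
have bu : fboundary u `<=` fdom f.
  apply/fsubsetP => v; rewrite in_fboundary => vu; apply: contraT => vf.
  have vY : v \in Y by apply: dY uY; apply: fproper_sub.
  have := umin v; rewrite inE vf vY => /(_ isT).
  by rewrite leqNgt fproper_ltn_card.
have fbu : fdom (restr f (fboundary u)) = fboundary u by apply/fsetIidPr.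
have [|h [Ah hdom hf]] := fill_boundary u0 (cardY u uY uf) _ fbu.
  apply: (restr_in hA) => //; last exact: down_closed_fboundary.
  by rewrite in_fboundary fproper0.
have domI : fdom f `&` fdom h = fboundary u.
  apply/fsetP => v; rewrite inE hdom fpowersetE in_fboundary fproperEneq.
  apply/andP/andP => -[]; first by move=> vf vu; split=> //; apply: contraNneq uf => <-.
  by move=> vu vs; split=> //; apply: (fsubsetP bu); rewrite in_fboundary fproperEneq vu.
have [|g [Ag gdom gf gh]] := glue2 hA Af Ah; first by rewrite domI hf.
rewrite hdom in gdom.
have gY : fdom g `<=` Y.
  by rewrite gdom fsubUset fY; apply: fpowerset_sub.
have [||k [Ak kdom kg]] := IHm g _ Ag gY.
- rewrite -ltnS; apply: leq_trans Ym; rewrite ltnS; apply: fproper_ltn_card.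
  apply/fproperP; split=> [v|].
    by rewrite gdom !inE negb_or => /andP[/andP[-> _] ->].
  exists u; first by rewrite inE uf.
  by rewrite gdom !inE fpowersetE fsubset_refl orbT.
- move=> v vY; rewrite gdom inE negb_or => /andP[vf _]; exact: cardY.
exists k; split=> //; rewrite -[RHS]gf -[in RHS]kg restr_restr //.
by rewrite gdom fsubsetUl.
Qed.

(* The fourth amenability axiom, applied at a vertex c, turns amalgamation of
   size at most n + 1 in the link of c into filling of sets of size n + 2. *)
Lemma fill_star s c f Y : A f -> fdom f `<=` fpowerset s ->
  [fset c] \in fdom f -> (forall u, u \in fdom f -> c |` u \in fdom f) ->
  down_closed Y -> Y `<=` fpowerset (s `\ c) ->
  fdom f `&` fpowerset (s `\ c) `<=` Y ->
  (forall u, u \in Y -> (#|` u| <= n.+1)%N) ->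
  exists g, [/\ A g, forall u, (u \in fdom g) = (u `\ c \in Y)
    & restr g (fdom f) = f].
Proof.
move=> Af fs cf cfU dY Ys fY cardY.
(* Closure of the domain under adding [c] makes the link of [c] equal to the part of the domain
   avoiding [c], as the extension axiom requires. *)
have linkE : link s [fset c] (fdom f) = fdom f `&` fpowerset (s `\ c).
  apply/fsetP => u; rewrite !inE /= andbC; apply: andb_id2r => _.
  apply/idP/idP => [|/cfU//]; apply: (A_down hA) => //; exact: fsubsetUr.
have [||g [Ag gdom gf]] :=
  @fill_skeleton (loc s [fset c] f) Y (amenable_loc hA Af fs cf) dY.
- by rewrite /= linkE.
- by move=> u uY _; apply: cardY.
have gs : fdom g `<=` fpowerset (s `\` [fset c]) by rewrite gdom.
have [g0 [Ag0 g0dom fg0 _]] := amenable_ext hA Af fs cf linkE Ag gs gf.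
exists g0; split=> // u; rewrite g0dom gdom.
apply/imfset2P/idP => [[v /= vY [w /=]]|uY].
  rewrite fpowersetE => wc ->.
  have vc : c \notin v.
    by have := fsubsetP Ys v vY; rewrite fpowersetE fsubsetD1 => /andP[].
  suff -> : (v `|` w) `\ c = v by [].
  apply/fsetP => x; rewrite !inE; case: (eqVneq x c) => [->|xc] /=.
    by rewrite (negPf vc).
  by case: (boolP (x \in w)) => [/(fsubsetP wc)|_]; rewrite ?orbF // inE (negPf xc).
exists (u `\ c) => //; exists (u `&` [fset c]); first by rewrite /= fpowersetE fsubsetIr.
by rewrite fsetUC fsetID.
Qed.

(** The two shells are glued, and the part around [c] is extended by [fill_star]. A face omitting x,
    with x different from a, b, c, contains [c] and is reached from the set omitting both x and [c],
    which has only n + 1 elements. *)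
Lemma fill_two_faces s a b c F1 F2 : #|` s| = n.+3 ->
  a \in s -> b \in s -> c \in s -> a != b -> a != c -> b != c ->
  A F1 -> A F2 -> fdom F1 = fboundary (s `\ a) -> fdom F2 = fboundary (s `\ b) ->
  restr F1 (fpowerset (s `\ a `\ b)) = restr F2 (fpowerset (s `\ a `\ b)) ->
  exists F, [/\ A F, restr F (fboundary (s `\ a)) = F1,
    restr F (fboundary (s `\ b)) = F2,
    forall x, x \in s -> x != a -> x != b -> x != c -> s `\ x \in fdom F
    & forall u, u `<=` s -> (#|` u| <= n.+1)%N -> u \in fdom F].
Proof.
move=> scard sa sb sc ab ac bc AF1 AF2 F1dom F2dom F12.
have cardD x : x \in s -> #|` s `\ x| = n.+2.
  by move=> /card_fsetD1; rewrite scard => -[].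
have domI : fdom F1 `&` fdom F2 = fpowerset (s `\ a `\ b).
  apply/fsetP => u; rewrite inE F1dom F2dom !in_fboundary fpowersetE.
  apply/andP/idP => [[/fproper_sub + /fproper_sub]|uab].
    by rewrite !fsubsetD1 => /andP[-> ->] /andP[_ ->].
  split; apply: (fsub_proper_trans uab).
    by rewrite fproperD1 // !inE eq_sym ab.
  by rewrite fsetDDl fsetUC -fsetDDl fproperD1 // !inE ab.
have [|F12' [AF12 X0dom F12F1 F12F2]] := glue2 hA AF1 AF2; first by rewrite domI.
move E : (fdom F1 `|` fdom F2) => X0 in X0dom; have X0E := esym E => {E}.
have dX0 : down_closed X0 by rewrite -X0dom; apply: (A_down hA).
have X0s u : u \in X0 -> u `<=` s.
  rewrite X0E inE F1dom F2dom !in_fboundary => /orP[] /fproper_sub us;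
  by apply: fsubset_trans us _; apply: fsubD1set.
have X0P u : u \in X0 = (u `<` s `\ a) || (u `<` s `\ b).
  by rewrite X0E inE F1dom F2dom !in_fboundary.
(* The closed star of [c]: the part of [X0] to which [fill_star] applies. *)
pose X := [fset u in X0 | c |` u \in X0].
have XE u : (u \in X) = (c |` u \in X0).
  rewrite !inE; apply: andb_idl; apply: dX0; exact: fsubsetUr.
have dX : down_closed X.
  by move=> u v uv; rewrite !XE; apply: dX0; apply: fsetUS.
have X_X0 : X `<=` X0.
  by apply/fsubsetP => u; rewrite XE; apply: dX0; apply: fsubsetUr.
have cX : [fset c] \in X.
  rewrite XE fsetUid X0P; apply/orP; left; rewrite fproperEcard cardfs1 cardD //.
  by rewrite andbT fsub1set !inE eq_sym ac.
have X_0 : fset0 \in X by apply: dX cX; apply: fsub0set.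
pose w0 := s `\ a `\ b `\ c.
have w0P x : (x \in w0) = [&& x != c, x != b, x != a & x \in s] by rewrite !inE.
(* Bases strictly containing [w0] are left out. For instance [w0] with [a] added lies in [X0] but
   not in [X], as adding [c] gives the unfilled face omitting [b]; a new functor defined there could
   not be glued to [F12']. *)
pose Y := [fset u in fpowerset (s `\ c) | ~~ (w0 `<` u)].
have YE u : (u \in Y) = (u `<=` s `\ c) && ~~ (w0 `<` u).
  by rewrite !inE /= fpowersetE.
have fdomX : fdom (restr F12' X) = X by rewrite /= X0dom; apply/fsetIidPr.
have [||||||||g [Ag gdom gX]] := @fill_star s c (restr F12' X) Y.
- exact: (restr_in hA).
- rewrite fdomX; apply/fsubsetP => u uX; rewrite fpowersetE.
  exact: X0s (fsubsetP X_X0 u uX).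
- by rewrite fdomX.
- by move=> u; rewrite fdomX !XE fsetUA fsetUid.
- move=> u v uv; rewrite !YE => /andP[vs w0v].
  rewrite (fsubset_trans uv vs); apply: contra w0v => w0u.
  exact: fproper_sub_trans uv.
- by apply/fsubsetP => u; rewrite YE fpowersetE => /andP[].
- apply/fsubsetP => u; rewrite inE fdomX XE X0P fpowersetE YE => /andP[ucX us].
  rewrite us /=; apply/negP => /fproperP[w0u [x xu xw0]].
  have /fsubsetP uS : u `<=` s by apply: fsubset_trans us _; apply: fsubD1set.
  have xc : x != c by have := fsubsetP us x xu; rewrite !inE => /andP[].
  have xab : (x == a) || (x == b).
    by move: xw0; rewrite w0P xc uS // andbT -negb_or negbK orbC.
  case/orP: ucX => /fproperP[subs [y]]; rewrite !inE => /andP[yna ys].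
    rewrite negb_or => /andP[yc yu].
    have xa : x != a by have := subs x; rewrite !inE xu orbT => /(_ isT)/andP[].
    rewrite (negPf xa) /= in xab; have [yb|yb] := eqVneq y b.
      by rewrite yb -(eqP xab) xu in yu.
    by rewrite w0u // w0P yc yb yna in yu.
  rewrite negb_or => /andP[yc yu].
  have xb : x != b by have := subs x; rewrite !inE xu orbT => /(_ isT)/andP[].
  rewrite (negPf xb) orbF in xab; have [ya|ya] := eqVneq y a.
    by rewrite ya -(eqP xab) xu in yu.
  by rewrite w0u // w0P yc ya yna in yu.
- move=> u; rewrite YE => /andP[us w0u]; rewrite leqNgt; apply/negP => un.
  have uE : u = s `\ c by apply/eqP; rewrite eqEfcard us cardD.
  case/negP: w0u; apply/fproperP; split=> [x|].
    by rewrite w0P uE !inE => /and4P[-> _ _ ->].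
  by exists a; rewrite ?w0P ?eqxx ?andbF // uE !inE ac.
rewrite fdomX in gX.
have glueI : fdom F12' `&` fdom g `<=` X.
  apply/fsubsetP => u; rewrite inE X0dom gdom XE => /andP[uX0 ugY].
  have [cu|cu] := boolP (c \in u); first by rewrite (fsetUidPr _ _ _) ?fsub1set.
  rewrite (mem_fsetD1 cu) YE in ugY; case/andP: ugY => usc w0u.
  rewrite X0P in uX0; rewrite X0P.
  (* Strictness could only fail if adding [c] to [u] gave all of [s] without [d]; then [u] would
     contain both [w0] and [e], which [Y] forbids. *)
  have absurd d e : [&& d \in s, e \in s, e != d, d != c & e != c] ->
      w0 `<=` s `\ d -> e \notin w0 -> u `<` s `\ d -> c != d -> c |` u `<` s `\ d.
    move=> /and5P[ds es ed dc ec] w0d ew0 ud cd; rewrite fproperEneq; apply/andP; split.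
      apply/eqP => ucE; case/negP: w0u; apply/fproperP; split.
        move=> x xw0; have := fsubsetP w0d x xw0; rewrite -ucE !inE.
        by move: xw0; rewrite w0P => /and4P[/negPf->].
      exists e => //; have : e \in s `\ d by rewrite !inE ed.
      by rewrite -ucE !inE (negPf ec).
    by rewrite fsubUset (fproper_sub ud) andbT fsub1set !inE cd.
  case/orP: uX0 => [ua|ub]; apply/orP; [left|right].
    apply: (absurd a b); rewrite ?sa ?sb ?(eq_sym b a) ?ab ?ac ?bc ?(eq_sym c a) //.
    - by apply/fsubsetP => x; rewrite w0P !inE => /and4P[_ _ -> ->].
    - by rewrite w0P eqxx andbF.
  apply: (absurd b a); rewrite ?sa ?sb ?ab ?ac ?bc ?(eq_sym c b) //.
  - by apply/fsubsetP => x; rewrite w0P !inE => /and4P[_ -> _ ->].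
  - by rewrite w0P eqxx !andbF.
have [|F [AF Fdom FF12 Fg]] := glue2 hA AF12 Ag.
  by apply: restr_eqS glueI _; rewrite gX.
have Frestr Z : Z `<=` X0 -> restr F Z = restr F12' Z.
  by move=> ZX0; rewrite -FF12 restr_restr // X0dom.
exists F; split=> //.
- by rewrite Frestr ?[X in restr _ X](_ : _ = fdom F1) // X0E -F1dom fsubsetUl.
- by rewrite Frestr ?[X in restr _ X](_ : _ = fdom F2) // X0E -F2dom fsubsetUr.
- move=> x xs xa xb xc; rewrite Fdom inE gdom YE; apply/orP; right.
  rewrite fsetSD ?fsubD1set //=; apply/negP => /fproper_sub/fsubsetP/(_ x).
  by rewrite w0P xa xb xc xs !inE eqxx /= andbF => /(_ isT).
- move=> u us un; rewrite Fdom inE X0dom X0P gdom YE.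
  (* A set missing [a] or [b] is in [X0] by its size. One containing both lies over [Y], since with
     [w0] inside it would contain all n + 2 elements of [s] other than [c]. *)
  have [ua|ua] := boolP (a \in u); last first.
    by rewrite [u `<` _]fproperEcard fsubsetD1 us ua cardD // ltnS un.
  have [ub|ub] := boolP (b \in u); last first.
    by rewrite [u `<` s `\ b]fproperEcard fsubsetD1 us ub cardD // ltnS un orbT.
  rewrite fsetSD //=; apply/orP; right; apply/negP => /fproper_sub/fsubsetP w0u.
  suff : s `\ c `<=` u by move/fsubset_leq_card; rewrite cardD // leqNgt ltnS un.
  apply/fsubsetP => y; rewrite !inE => /andP[yc ys].
  have [->//|ya] := eqVneq y a; have [->//|yb] := eqVneq y b.
  by have := w0u y; rewrite w0P yc yb ya ys !inE yc => /(_ isT).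
Qed.

End Amalgamation.

(** * Signs and boundaries *)

Section Signs.
Local Open Scope ring_scope.
Implicit Types (s t u : {fset nat}).

Definition below s x : nat := #|` [fset y in s | (y < x)%N]|.

(** The sign of the face omitting [x], with faces named by the omitted vertex instead of its
    position. *)
Definition sgn s x : int := (-1) ^+ below s x.

Lemma sgn_sq s x : sgn s x * sgn s x = 1.
Proof. by rewrite /sgn -expr2 sqrr_sign. Qed.

Lemma belowD1 s x y : below s y = ((x \in s) && (x < y) + below (s `\ x) y)%N.
Proof.
rewrite /below (cardfsD1 x); congr (_ + _)%N; first by rewrite !inE.
by congr #|` _|; apply/fsetP => z; rewrite !inE /= andbA.
Qed.

(** Deleting the smaller vertex first lowers the position of the larger by one; deleting the larger
    first leaves the smaller in place. *)
Lemma sgn_swap s x y : x \in s -> y \in s -> x != y ->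
  sgn s x * sgn (s `\ x) y = - (sgn s y * sgn (s `\ y) x).
Proof.
wlog xy : x y / (x < y)%N => [th|] xs ys nxy.
  case: (ltngtP x y) nxy => // [xy|yx] _; first by apply: th => //; rewrite ltn_eqF.
  by rewrite (th y x) ?opprK // ltn_eqF.
rewrite {1 3}/sgn (belowD1 s y x) (belowD1 s x y) xs ys xy /= ltnNge ltnW //=.
by rewrite exprS mulN1r mulNr opprK mulrC.
Qed.

(** Terms above the diagonal cancel those below. The embedding [m] into the naturals lets this serve
    both vertices and ordinals. *)
Lemma antisym_sum (M : zmodType) (I : eqType) (m : I -> nat) (r : seq I)
    (T : I -> I -> M) : injective m ->
  (forall x y, x \in r -> y \in r -> (m x < m y)%N -> T x y = - T y x) ->
  \sum_(x <- r) \sum_(y <- r | y != x) T x y = 0.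
Proof.
move=> m_inj antiT.
have -> : \sum_(x <- r) \sum_(y <- r | y != x) T x y =
    \sum_(x <- r) \sum_(y <- r | (m x < m y)%N) T x y +
    \sum_(x <- r) \sum_(y <- r | (m y < m x)%N) T x y.
  rewrite -big_split; apply: eq_bigr => x _ /=.
  rewrite (bigID (fun y => (m x < m y)%N)) /=; congr (_ + _); apply: eq_bigl => y;
    by rewrite -(inj_eq m_inj); case: (ltngtP (m x) (m y)).
rewrite (exchange_big_dep xpredT) //= -big_split /=.
rewrite big_seq big1 // => y yr; rewrite -big_split /= big_seq_cond.
rewrite big1 // => x /andP[xr xy]; rewrite antiT ?addNr //.
Qed.

Lemma big_fsetD1_cond (M : zmodType) s x (g : nat -> M) :
  \sum_(y <- s `\ x) g y = \sum_(y <- s | y != x) g y.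
Proof.
rewrite (big_fset_condE _ s) /=; apply: eq_fbigl => y.
by rewrite !inE /= andbC.
Qed.

(** The cancellation behind the vanishing of the squared differential: [G x y] stands for the face
    omitting both vertices. *)
Lemma double_sum (M : lmodType int) s (G : nat -> nat -> M) :
  (forall x y, G x y = G y x) ->
  \sum_(x <- s) sgn s x *: \sum_(y <- s `\ x) sgn (s `\ x) y *: G x y = 0.
Proof.
move=> symG.
under eq_bigr => x _.
  rewrite big_fsetD1_cond scaler_sumr; under eq_bigr => y _ do rewrite scalerA.
  over.
apply: (antisym_sum (m := id)) => // x y xs ys xy.
by rewrite sgn_swap // ?ltn_eqF // scaleNr symG.
Qed.

Lemma below_nth s i : (i < #|` s|)%N -> below s (nth 0%N (sort leq s) i) = i.
Proof.
move=> iltn; set r := sort leq s; set x := nth _ _ _.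
have ir : (i < size r)%N by rewrite size_sort_fset.
have rs : perm_eq r s by rewrite perm_sort.
rewrite /below -sum1_size big_fset /= -(perm_big _ rs) /= sum1_count.
rewrite -(cat_take_drop i r) count_cat.
have ltnr := sorted_ltn_nth ltn_trans 0%N (sort_fset_sorted s).
have -> : count (fun y => y < x)%N (take i r) = i.
  rewrite -[RHS](size_takel (ltnW ir)); apply/eqP; rewrite -all_count.
  apply/(all_nthP 0%N) => j; rewrite size_takel ?(ltnW ir) // => ji.
  by rewrite nth_take // ltnr // inE ?(ltn_trans ji).
apply/eqP; rewrite -[X in _ == X]addn0 eqn_add2l -leqn0 leqNgt -has_count.
apply/negP => /(has_nthP 0%N) [j]; rewrite size_drop => jr.
rewrite nth_drop ltnNge => /negP; apply.
have ijr : (i + j < size r)%N by lia.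
by rewrite (sorted_leq_nth leq_trans leqnn) ?(sort_sorted leq_total) ?inE ?leq_addr.
Qed.

(** Passes from faces numbered by position, as in [bd], to faces named by the omitted vertex. *)
Lemma sum_sorted (M : lmodType int) s m (g : nat -> M) : #|` s| = m ->
  \sum_(i < m) (-1 : int) ^+ i *: g (nth 0%N (sort leq s) i) =
  \sum_(x <- s) sgn s x *: g x.
Proof.
move=> <-; have rs : perm_eq (sort leq s) s by rewrite perm_sort.
rewrite -(perm_big _ rs) (big_nth 0%N) size_sort_fset big_mkord /=.
by apply: eq_bigr => i _; rewrite /sgn below_nth.
Qed.

End Signs.

Section FreegLift.
Local Open Scope ring_scope.
Context (K : choiceType) (M : lmodType int) (h : K -> M).

(** Integer scaling is repeated addition up to sign, so additivity suffices. *)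
Fact fglift_is_linear : linear (fglift h : {freeg K} -> M).
Proof.
have liftB := lift_is_additive h.
have lift0 : fglift h 0 = 0 by rewrite -(subrr (0 : {freeg K})) liftB subrr.
have liftN x : fglift h (- x) = - fglift h x by rewrite -sub0r liftB lift0 sub0r.
have liftD x y : fglift h (x + y) = fglift h x + fglift h y.
  by rewrite -[y in LHS]opprK liftB liftN opprK.
have liftn (m : nat) x : fglift h (x *+ m) = fglift h x *+ m.
  by elim: m => [|m IHm]; rewrite ?mulr0n // !mulrS liftD IHm.
move=> k x y; rewrite liftD -[k]intz !scaler_int; congr (_ + _).
by case: k => m; rewrite ?NegzE -?pmulrn -?nmulrn ?liftN liftn.
Qed.

HB.instance Definition _ :=
  GRing.isLinear.Build int {freeg K} M *:%R (fglift h : {freeg K} -> M)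
    fglift_is_linear.

End FreegLift.

Section Boundaries.
Local Open Scope ring_scope.
Context (C : category) (A : set (functor C)) (B : C).
Implicit Types (f g F G : functor C) (X Y : {fset {fset nat}}).
Implicit Types (s t u v w T : {fset nat}).

(** In this form, being over [B] passes freely between a functor and any restriction that keeps the
    empty set. *)
Lemma over_baseP f : over_base B f <-> ar f fset0 fset0 = Some (Arrow (idm B)).
Proof.
split=> [[B0 fB]|fB].
  by rewrite (@ar_val C f [` B0] [` B0] (fsubset_refl _)) farr_id fB.
have B0 : fset0 \in fdom f by rewrite fdom_ar fB.
exists B0; move: fB; rewrite (@ar_val C f [` B0] [` B0] (fsubset_refl _)) farr_id.
by move=> /Some_inj/(congr1 (@src C)).
Qed.

Lemma over_restr f X : over_base B f -> fset0 \in X -> over_base B (restr f X).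
Proof. by move=> /over_baseP fB X0; apply/over_baseP; rewrite ar_restr X0. Qed.

Lemma over_extend f g X : restr g X = f -> over_base B f -> over_base B g.
Proof.
move=> <- /over_baseP; rewrite ar_restr; case: ifP => // _ gB; exact/over_baseP.
Qed.

(** Only proper subsets of [T] are read, so [F] may be defined on [fboundary T] alone: for a simplex
    on [T] this is its differential, for a shell it is the shell as a chain. *)
Definition bdry F T : chain C :=
  \sum_(x <- T) sgn T x *: basis (restr F (fpowerset (T `\ x))).

Lemma eq_bdry F G T : restr F (fboundary T) = restr G (fboundary T) ->
  bdry F T = bdry G T.
Proof.
move=> FG; apply: eq_big_seq => x xT; congr (_ *: basis _).
apply: restr_eqS FG; apply/fsubsetP => u; rewrite fpowersetE in_fboundary => uT.
by apply: fsub_proper_trans uT _; apply: fproperD1.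
Qed.

(** The identity is formal in the restrictions, so it applies to a partial [F]; faces that [F] lacks
    contribute their shells. *)
Lemma bdry_bdry F s : \sum_(x <- s) sgn s x *: bdry F (s `\ x) = 0.
Proof.
apply: double_sum => x y; congr (basis (restr F (fpowerset _))).
by rewrite !fsetDDl fsetUC.
Qed.

Lemma supp_simplex f T : fdom f = fpowerset T -> supp f = T.
Proof.
rewrite /supp => ->; apply/eqP; rewrite eqEfsubset; apply/andP; split.
  apply/fsubsetP => x /bigfcupP[u]; rewrite andbT fpowersetE => uT.
  exact: (fsubsetP uT).
apply/fsubsetP => x xT; apply/bigfcupP; exists T => //.
by rewrite andbT fpowersetE.
Qed.

Lemma bd_basis f T m : fdom f = fpowerset T -> #|` T| = m.+1 ->
  bd m (basis f) = bdry f T.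
Proof.
move=> fT Tm; rewrite /bd /basis liftU scale1r /face (supp_simplex fT).
exact: (sum_sorted (fun x => basis (restr f (fpowerset (T `\ x)))) Tm).
Qed.

HB.instance Definition _ m :=
  GRing.Linear.copy (bd m : chain C -> chain C) (fglift _ : chain C -> chain C).

Lemma chains0 m : chains A B m 0.
Proof. by move=> f; rewrite dom0. Qed.

Lemma chainsP m k (x y : chain C) :
  chains A B m x -> chains A B m y -> chains A B m (k *: x + y).
Proof.
move=> hx hy f /domD_subset; rewrite mem_cat => /orP[/domZ_subset|]; first exact: hx.
exact: hy.
Qed.

Lemma mem_dom_basis f (g : {classic (functor C)}) : g \in dom (basis f) -> g = f.
Proof. by rewrite /basis domU1 mem_seq1 => /eqP. Qed.

Lemma chains_basis m f : simplex_over A B m f -> chains A B m (basis f).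
Proof. by move=> hf g /mem_dom_basis ->. Qed.

Lemma chains_sum m (I : Type) (r : seq I) (P : pred I) (x : I -> chain C) :
  (forall i, P i -> chains A B m (x i)) -> chains A B m (\sum_(i <- r | P i) x i).
Proof.
move=> hx; elim/big_ind: _ => //; first exact: chains0.
by move=> a b ha hb; rewrite -[a]scale1r; apply: chainsP.
Qed.

Lemma boundaries0 m : boundaries A B m 0.
Proof. by exists 0; [exact: chains0|rewrite linear0]. Qed.

Lemma boundariesP m k (x y : chain C) :
  boundaries A B m x -> boundaries A B m y -> boundaries A B m (k *: x + y).
Proof.
move=> [x' hx <-] [y' hy <-]; exists (k *: x' + y'); first exact: chainsP.
by rewrite linearP.
Qed.

Lemma boundariesD m (x y : chain C) :
  boundaries A B m x -> boundaries A B m y -> boundaries A B m (x + y).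
Proof. by move=> hx; rewrite -[x]scale1r; apply: boundariesP. Qed.

Lemma boundariesZ m k (x : chain C) : boundaries A B m x -> boundaries A B m (k *: x).
Proof.
move=> hx; rewrite -[_ *: _]addr0.
by apply: boundariesP => //; apply: boundaries0.
Qed.

Lemma boundaries_sum m (I : eqType) (r : seq I) (x : I -> chain C) :
  (forall i, i \in r -> boundaries A B m (x i)) -> boundaries A B m (\sum_(i <- r) x i).
Proof.
move=> hx; rewrite big_seq; elim/big_ind: _ => //; first exact: boundaries0.
exact: boundariesD.
Qed.

Lemma boundaries_bdry m f T : A f -> over_base B f -> fdom f = fpowerset T ->
  #|` T| = m.+2 -> boundaries A B m (bdry f T).
Proof.
move=> Af fB fT Tm; exists (basis f); last exact: bd_basis.
by apply: chains_basis; split=> //; exists T.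
Qed.

End Boundaries.

(** * Shells *)

Lemma exists_fresh (T : {fset nat}) : exists a, forall x, x \in T -> (x < a)%N.
Proof.
exists (\sum_(x <- T) x).+1 => x xT; rewrite ltnS (big_fsetD1 x) //=.
exact: leq_addr.
Qed.

Lemma exists_disjoint (T : {fset nat}) m :
  exists T', #|` T'| = m /\ forall x, x \in T' -> x \notin T.
Proof.
elim: m => [|m [T' [T'm TT']]]; first by exists fset0; rewrite cardfs0.
have [a afresh] := exists_fresh (T `|` T').
have aN : a \notin T `|` T' by apply/negP => /afresh; rewrite ltnn.
move: aN; rewrite inE negb_or => /andP[aT aT'].
exists (a |` T'); rewrite cardfsU1 aT' T'm; split=> // x.
by rewrite !inE => /orP[/eqP -> //|/TT'].
Qed.

Lemma card_gtD (K : choiceType) (s t : {fset K}) : (#|` t| < #|` s|)%N ->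
  exists2 x, x \in s & x \notin t.
Proof.
move=> ts; apply/fsubsetPn; apply: contraTN ts => /fsubset_leq_card.
by rewrite -leqNgt.
Qed.

Section Shells.
Local Open Scope ring_scope.
Context (C : category) (A : set (functor C)) (n : nat).
Context (hA : amenable A) (hCA : complete_amalgamation A n.+1).
Context (hS : strong_2_amalgamation A) (hn : (1 <= n)%N).
Context (B : C) (hB : exists f : functor C, A f /\ over_base B f).
Implicit Types (f g F G : functor C) (X Y : {fset {fset nat}}).
Implicit Types (s t u v w D E T : {fset nat}) (p q r : chain C).

Definition homol p q : Prop := boundaries A B n (p - q).

Lemma homol_refl p : homol p p.
Proof. by rewrite /homol subrr; apply: boundaries0. Qed.

Lemma homolZ k p q : homol p q -> homol (k *: p) (k *: q).
Proof. by rewrite /homol -scalerBr; apply: boundariesZ. Qed.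

Lemma homol_sym p q : homol p q -> homol q p.
Proof. by move=> pq; have := boundariesZ (-1) pq; rewrite scaleN1r opprB. Qed.

Lemma homolD p q p' q' : homol p q -> homol p' q' -> homol (p + p') (q + q').
Proof. by rewrite /homol opprD addrACA; apply: boundariesD. Qed.

Lemma homol_trans q p r : homol p q -> homol q r -> homol p r.
Proof. by move=> pq qr; have := boundariesD pq qr; rewrite addrA subrK. Qed.

(** A shell as a single functor on the proper subsets of [T], instead of a compatible list of
    simplices. *)
Definition shell_on T F : Prop :=
  [/\ A F, fdom F = fboundary T & over_base B F].

Lemma fboundary_sub T : fboundary T `<=` fpowerset T.
Proof. exact: fsubsetDl. Qed.

Lemma fset0_fboundary T : (0 < #|` T|)%N -> fset0 \in fboundary T.
Proof. by rewrite in_fboundary fproper0 cardfs_gt0. Qed.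

Lemma bdry_restr F T X : fboundary T `<=` X -> bdry (restr F X) T = bdry F T.
Proof. by move=> TX; apply: eq_bdry; rewrite restr_restr. Qed.

Lemma shell_restr T F : (0 < #|` T|)%N -> A F -> over_base B F ->
  fboundary T `<=` fdom F -> shell_on T (restr F (fboundary T)).
Proof.
move=> T0 AF FB TF; split; last exact: over_restr (fset0_fboundary T0).
  by apply: (restr_in hA) => //; [exact: fset0_fboundary|exact: down_closed_fboundary].
exact/fsetIidPr.
Qed.

(** In [bdry_bdry] for the functor of [fill_two_faces], every term except those of [a], [b], [c] is
    the boundary of a simplex. *)
Lemma shell_join s a b c F1 F2 : #|` s| = n.+3 ->
  a \in s -> b \in s -> c \in s -> a != b -> a != c -> b != c ->
  shell_on (s `\ a) F1 -> shell_on (s `\ b) F2 ->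
  restr F1 (fpowerset (s `\ a `\ b)) = restr F2 (fpowerset (s `\ a `\ b)) ->
  exists F3, [/\ shell_on (s `\ c) F3,
    restr F3 (fpowerset (s `\ a `\ c)) = restr F1 (fpowerset (s `\ a `\ c)),
    restr F3 (fpowerset (s `\ b `\ c)) = restr F2 (fpowerset (s `\ b `\ c))
    & homol (sgn s a *: bdry F1 (s `\ a) + sgn s b *: bdry F2 (s `\ b) +
             sgn s c *: bdry F3 (s `\ c)) 0].
Proof.
move=> scard sa sb sc ab ac bc [AF1 F1dom F1B] [AF2 F2dom F2B] F12.
have cardD x : x \in s -> #|` s `\ x| = n.+2.
  by move=> /card_fsetD1; rewrite scard => -[].
have [F [AF FF1 FF2 Fx Fu]] :=
  fill_two_faces hA hCA scard sa sb sc ab ac bc AF1 AF2 F1dom F2dom F12.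
have FB : over_base B F by apply: over_extend F1B; apply: FF1.
have bsub x : x \in s -> fboundary (s `\ x) `<=` fdom F.
  move=> xs; apply/fsubsetP => u; rewrite in_fboundary => us; apply: Fu.
    by apply: fsubset_trans (fproper_sub us) _; apply: fsubD1set.
  by have := fproper_ltn_card us; rewrite cardD.
have subb x y : x \in s -> y \in s -> x != y ->
    fpowerset (s `\ x `\ y) `<=` fboundary (s `\ x) /\
    fpowerset (s `\ x `\ y) `<=` fboundary (s `\ y).
  move=> xs ys xy; split; apply/fsubsetP => u; rewrite fpowersetE in_fboundary => us.
    by apply: fsub_proper_trans us _; apply: fproperD1; rewrite !inE eq_sym xy.
  apply: fsub_proper_trans us _; rewrite fsetDDl fsetUC -fsetDDl.
  by apply: fproperD1; rewrite !inE xy.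
exists (restr F (fboundary (s `\ c))); split.
- apply: shell_restr; [by rewrite cardD|by []|by []|exact: bsub].
- have [ac1 ac2] := subb a c sa sc ac.
  by rewrite restr_restr // -FF1 restr_restr.
- have [bc1 bc2] := subb b c sb sc bc.
  by rewrite restr_restr // -FF2 restr_restr.
rewrite bdry_restr //.
have -> : bdry F1 (s `\ a) = bdry F (s `\ a) by rewrite -FF1 bdry_restr.
have -> : bdry F2 (s `\ b) = bdry F (s `\ b) by rewrite -FF2 bdry_restr.
have := bdry_bdry F s.
rewrite (big_fsetD1 a) //= (big_fsetD1 b) /=; last by rewrite !inE eq_sym ab.
rewrite (big_fsetD1 c) /=; last by rewrite !inE ![c == _]eq_sym bc ac.
rewrite !addrA => /eqP; rewrite addr_eq0 => /eqP ->.
rewrite /homol subr0 -scaleN1r; apply: boundariesZ; apply: boundaries_sum => x.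
rewrite !inE => /and4P[xc xb xa xs]; apply: boundariesZ.
rewrite -(@bdry_restr _ _ (fpowerset (s `\ x)) (fboundary_sub _)).
apply: boundaries_bdry; rewrite ?cardD //.
- exact: (restr_fpowerset_in hA).
- by apply: over_restr => //; rewrite fpowersetE fsub0set.
- by rewrite (restr_fpowerset_dom hA) // Fx.
Qed.

(** Strong 2-amalgamation of [G] with the face of [F] omitting [b] gives a simplex on [s] without
    [b]. Its boundary is null-homologous, so [shell_join] relates [F] and [F'] alone; since [E]
    avoids [b] and [c], [G] survives as a face of [F']. *)
Lemma shell_step s a b c E F G : #|` s| = n.+3 ->
  a \in s -> b \in s -> c \in s -> a != b -> a != c -> b != c ->
  shell_on (s `\ a) F -> A G -> fdom G = fpowerset E ->
  a \in E -> E `<=` s `\ b `\ c ->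
  restr F (fpowerset (E `\ a)) = restr G (fpowerset (E `\ a)) ->
  exists F', [/\ shell_on (s `\ c) F', restr F' (fpowerset E) = G
    & homol (bdry F (s `\ a)) (- (sgn s a * sgn s c) *: bdry F' (s `\ c))].
Proof.
move=> scard sa sb sc ab ac bc shF AG Gdom aE Esub FG.
have [AF Fdom FB] := shF.
have EP x : x \in E -> [/\ x != c, x != b & x \in s].
  by move=> /(fsubsetP Esub); rewrite !inE => /and3P[].
have cardD x : x \in s -> #|` s `\ x| = n.+2.
  by move=> /card_fsetD1; rewrite scard => -[].
have abF : s `\ a `\ b \in fdom F.
  by rewrite Fdom in_fboundary; apply: fproperD1; rewrite !inE eq_sym ab.
have EI : (s `\ a `\ b) `&` E = E `\ a.
  apply/fsetP => x; rewrite !inE andbC; case: (boolP (x \in E)) => [/EP[_ -> ->]|].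
    by rewrite /= !andbT.
  by rewrite andbF.
have EU : (s `\ a `\ b) `|` E = s `\ b.
  apply/fsetP => x; rewrite !inE; apply/orP/andP => [[/and3P[-> _ ->]//|/EP[_ -> ->]//]|].
  by move=> [xb xs]; case: (eqVneq x a) => [->|xa]; [right|left; rewrite xb xs].
have [|h [Ah hdom Fh Gh]] := hS (restr_fpowerset_in hA _ AF) AG
    (restr_fpowerset_dom hA AF abF) Gdom.
  by rewrite EI restr_restr // fpowersetS -EI fsubsetIl.
rewrite EU in hdom; rewrite /extends Gdom in Gh.
rewrite /extends (restr_fpowerset_dom hA AF abF) in Fh.
have hB' : over_base B h.
  apply: over_extend Fh _; apply: over_restr => //.
  by rewrite fpowersetE fsub0set.
have shh : shell_on (s `\ b) (restr h (fboundary (s `\ b))).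
  by apply: shell_restr; rewrite ?cardD ?hdom // fboundary_sub.
have subb : fpowerset (s `\ a `\ b) `<=` fboundary (s `\ b).
  apply/fsubsetP => u; rewrite fpowersetE in_fboundary => us.
  apply: fsub_proper_trans us _; rewrite fsetDDl fsetUC -fsetDDl.
  by apply: fproperD1; rewrite !inE ab.
have [|F3 [shF3 _ F3h hom3]] := shell_join scard sa sb sc ab ac bc shF shh.
  by rewrite restr_restr.
exists F3; split=> //.
  rewrite -(@restr_restr _ _ (fpowerset (s `\ b `\ c))) ?fpowersetS // F3h.
  rewrite restr_restr ?fpowersetS // restr_restr //.
  apply/fsubsetP => u; rewrite fpowersetE in_fboundary => uE.
  apply: fsub_proper_trans (fsubset_trans uE Esub) _.
  by apply: fproperD1; rewrite !inE eq_sym bc.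
rewrite bdry_restr // in hom3.
have hom2 : homol (sgn s b *: bdry h (s `\ b)) 0.
  by rewrite /homol subr0; apply/boundariesZ/boundaries_bdry; rewrite ?cardD.
(* The relation is multiplied by [sgn s a], its own inverse, and the null-homologous term of [h] is
   removed. *)
have := homolD (homolZ (sgn s a) hom3) (homolZ (- sgn s a) hom2).
rewrite !scaler0 addr0 /homol subr0 !scalerDr !scalerA sgn_sq scale1r.
by rewrite mulNr !scaleNr opprK addrAC addrK.
Qed.

End Shells.

(** * Moving and adding shells up to homology *)

Section ShellGroup.
Local Open Scope ring_scope.
Context (C : category) (A : set (functor C)) (n : nat).
Context (hA : amenable A) (hCA : complete_amalgamation A n.+1).
Context (hS : strong_2_amalgamation A) (hn : (1 <= n)%N).
Context (B : C) (hB : exists f : functor C, A f /\ over_base B f).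
Implicit Types (f g F G : functor C).
Implicit Types (s t u v w D E T : {fset nat}) (p q r : chain C).

Local Notation "p ~h q" := (homol A n B p q) (at level 70).
Local Notation shell := (shell_on A B).

Lemma restr_fset0 f g : over_base B f -> over_base B g ->
  restr f (fpowerset fset0) = restr g (fpowerset fset0).
Proof.
move=> /over_baseP fB /over_baseP gB; apply/restr_eqP => u v.
by rewrite !fpowersetE !fsubset0 => /eqP -> /eqP ->; rewrite fB gB.
Qed.

(** Filling starts from a member of [A] over [B], cut down to the empty set. *)
Lemma extend_base Y : down_closed Y -> fset0 \in Y ->
  (forall u, u \in Y -> (#|` u| <= n.+1)%N) ->
  exists G, [/\ A G, fdom G = Y & over_base B G].
Proof.
move=> dY Y0 cardY; have [f [Af fB]] := hB.
have f0 := A_fset0 hA Af.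
have f0B : over_base B (restr f (fpowerset fset0)).
  by apply: over_restr; rewrite // fpowersetE.
have [||||G [AG GY Gf]] := @fill_skeleton _ _ _ hA hCA (restr f (fpowerset fset0)) Y.
- exact: restr_fpowerset_in.
- exact: dY.
- rewrite (restr_fpowerset_dom hA Af f0); apply/fsubsetP => u.
  by rewrite fpowersetE fsubset0 => /eqP ->.
- by move=> u uY _; apply: cardY.
by exists G; split=> //; apply: over_extend Gf f0B.
Qed.

Lemma exists_shell T : #|` T| = n.+2 -> exists F, shell T F.
Proof.
move=> Tn; have [|||F [AF FT FB]] := @extend_base (fboundary T).
- exact: down_closed_fboundary.
- by rewrite in_fboundary fproper0 -cardfs_gt0 Tn.
- by move=> u; rewrite in_fboundary => /fproper_ltn_card; rewrite Tn.
by exists F.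
Qed.

(** The sign is fixed before the shell, so signs multiply under composition. *)
Definition moves T T' (e : int) : Prop := forall F, shell T F ->
  exists2 F', shell T' F' & bdry F T ~h e *: bdry F' T'.

Lemma moves_trans T T' T'' e e' :
  moves T T' e -> moves T' T'' e' -> moves T T'' (e * e').
Proof.
move=> m m' F /m[F' /m'[F'' sh'' F'F''] FF']; exists F'' => //.
by apply: homol_trans FF' _; rewrite -scalerA; apply: homolZ.
Qed.

(** With [E] the singleton of [a], [shell_step] asks for agreement on the empty set only, which is
    automatic over [B]. Any third vertex serves as [b]. *)
Lemma moves_step s a c : #|` s| = n.+3 -> a \in s -> c \in s -> a != c ->
  moves (s `\ a) (s `\ c) (- (sgn s a * sgn s c)).
Proof.
move=> scard sa sc ac F shF.
have [b] : exists2 b, b \in s & b \notin [fset a; c].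
  by apply: card_gtD; rewrite scard cardfs2; case: (_ != _); lia.
move=> sb; rewrite !inE negb_or => /andP[ba bc].
have [|||G [AG GE GB]] := @extend_base (fpowerset [fset a]).
- exact: down_closed_fpowerset.
- by rewrite fpowersetE.
- by move=> u; rewrite fpowersetE => /fsubset_leq_card; rewrite cardfs1; lia.
have [|||F' [shF' _ FF']] := @shell_step _ _ _ hA hCA hS B s a b c [fset a] F G
  scard sa sb sc _ ac bc shF AG GE (fset11 a).
- by rewrite eq_sym.
- by rewrite fsub1set !inE ac eq_sym ba.
- by rewrite fsetDv; apply: restr_fset0 => //; case: shF.
by exists F'.
Qed.

Lemma card_fsetU1 a T : a \notin T -> #|` a |` T| = #|` T|.+1.
Proof. by move=> aT; rewrite cardfsU1 aT. Qed.

Lemma moves_exists T T' : #|` T| = n.+2 -> #|` T'| = n.+2 ->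
  exists2 e, e * e = 1 & moves T T' e.
Proof.
move=> + T'n; have [m] := ubnP #|` T' `\` T|.
elim: m T => // m IHm T Tm Tn.
have [TT'|] := boolP (T' `<=` T).
  exists 1; first by rewrite mulr1.
  have -> : T' = T by apply/eqP; rewrite eqEfcard TT' Tn T'n /=.
  by move=> F shF; exists F => //; rewrite scale1r; apply: homol_refl.
move/fsubsetPn => [a aT' aT].
(* By size some vertex of [T] lies outside [T'] without [a]; it differs from [a], hence is outside
   [T']. Exchanging it for [a] brings [T] closer to [T']. *)
have [c cT cT'] : exists2 c, c \in T & c \notin T' `\ a.
  by apply: card_gtD; rewrite Tn -ltnS -card_fsetD1 // T'n.
have ac : a != c by apply: contraNneq aT => ->.
have aTn := card_fsetU1 aT; rewrite Tn in aTn.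
have [e e1 me] : exists2 e, e * e = 1 & moves ((a |` T) `\ c) T' e.
  apply: IHm; last first.
    by apply: succn_inj; rewrite -card_fsetD1 // !inE cT orbT.
  rewrite -ltnS; apply: leq_trans Tm; rewrite ltnS; apply: fproper_ltn_card.
  apply/fproperP; split=> [x|].
    rewrite !inE => /andP[+ xT']; rewrite xT' andbT negb_and negb_or negbK.
    case/orP => [/eqP xc|/andP[]//].
    by move: cT'; rewrite !inE -xc xT' andbT negbK xc eq_sym (negPf ac).
  by exists a; rewrite !inE ?aT ?aT' // ac eqxx.
have ms := @moves_step (a |` T) a c aTn (fset1U1 _ _) _ ac.
rewrite fsetU1K // in ms.
exists (- (sgn (a |` T) a * sgn (a |` T) c) * e); last first.
  by apply: moves_trans me; apply: ms; rewrite !inE cT orbT.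
rewrite mulrACA e1 mulr1 mulrNN mulrACA !sgn_sq mulr1 //.
Qed.

(* Moving the missing vertex of a set of size n + 3 once around a 3-cycle. *)
Lemma moves_opp T : #|` T| = n.+2 -> moves T T (-1).
Proof.
move=> Tn; have [a afresh] := exists_fresh T.
have aT : a \notin T by apply/negP => /afresh; rewrite ltnn.
have aTn := card_fsetU1 aT; rewrite Tn in aTn.
have [c cT _] : exists2 c, c \in T & c \notin fset0.
  by apply: card_gtD; rewrite Tn cardfs0.
have [b bT] : exists2 b, b \in T & b \notin [fset c].
  by apply: card_gtD; rewrite Tn cardfs1.
rewrite inE => bc.
have ca : c != a by apply: contraNneq aT => <-.
have ba : b != a by apply: contraNneq aT => <-.
set s := a |` T in aTn.
have [sa sb sc] : [/\ a \in s, b \in s & c \in s] by rewrite !inE bT cT eqxx !orbT.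
have mac := moves_step aTn sa sc; have mcb := moves_step aTn sc sb.
have mba := moves_step aTn sb sa.
have := moves_trans (moves_trans (mac _) (mcb _)) (mba ba).
rewrite eq_sym ca eq_sym bc => /(_ isT isT); rewrite fsetU1K //.
suff -> : - (sgn s a * sgn s c) * - (sgn s c * sgn s b) *
    - (sgn s b * sgn s a) = -1 by [].
(* Each vertex sign occurs twice, leaving only the three minus signs. *)
transitivity (- ((sgn s a * sgn s a) * (sgn s b * sgn s b) * (sgn s c * sgn s c))).
  by ring.
by rewrite !sgn_sq !mulr1.
Qed.

(* The target support and the sign depend on D and T only, so that one choice
   serves all shells on T. *)
Lemma shell_align D T : #|` D| = n.+1 -> #|` T| = n.+2 ->
  exists e T', [/\ e * e = 1, #|` T'| = n.+2, D `<=` T', T' `<=` D `|` T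
    & forall G F, A G -> fdom G = fpowerset D -> shell T F ->
      restr F (fpowerset (D `&` T)) = restr G (fpowerset (D `&` T)) ->
      exists F', [/\ shell T' F', restr F' (fpowerset D) = G
        & bdry F T ~h e *: bdry F' T']].
Proof.
move=> Dn; have [m] := ubnP #|` D `\` T|.
elim: m T => // m IHm T Tm Tn.
have [DT|] := boolP (D `<=` T).
  exists 1, T; split=> //; first exact: fsubsetUr.
  move=> G F AG GD shF; rewrite (fsetIidPl _) // => FG.
  exists F; split=> //; last by rewrite scale1r; apply: homol_refl.
  by rewrite FG restr_id // GD.
move/fsubsetPn => [a aD aT].
(* As [a] is in [D] but not in [T], at least two vertices of [T] lie outside [D]: [c] is exchanged
   for [a], and the face omitting [b] gets filled. *)
have DTn : (#|` D `&` T| <= n)%N.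
  have : D `&` T `<=` D `\ a.
    apply/fsubsetP => x; rewrite !inE => /andP[-> xT]; rewrite andbT.
    by apply: contraNneq aT => <-.
  by move/fsubset_leq_card => h; apply: leq_trans h _; rewrite -ltnS -card_fsetD1 ?Dn.
have [c cT cD] : exists2 c, c \in T & c \notin D `&` T.
  by apply: card_gtD; rewrite Tn; lia.
have [b bT] : exists2 b, b \in T & b \notin c |` (D `&` T).
  by apply: card_gtD; rewrite Tn cardfsU1 cD; lia.
rewrite inE cT andbT in cD; rewrite !inE bT andbT negb_or => /andP[bc bD].
have ca : c != a by apply: contraNneq aT => <-.
have ba : b != a by apply: contraNneq aT => <-.
have aTn := card_fsetU1 aT; rewrite Tn in aTn.
set s := a |` T in aTn.
have [sa sb sc] : [/\ a \in s, b \in s & c \in s] by rewrite !inE bT cT eqxx !orbT.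
have sDE : D `&` (s `\ c) = a |` (D `&` T).
  apply/fsetP => x; rewrite !inE; case: (eqVneq x a) => [->|xa].
    by rewrite aD eq_sym ca.
  by case: (eqVneq x c) => [->|xc] //=; rewrite (negPf cD) //= andbF.
have [||e1 [T' [e1e1 T'n DT' T'D mv]]] := IHm (s `\ c).
- rewrite -ltnS; apply: leq_trans Tm; rewrite ltnS; apply: fproper_ltn_card.
  apply/fproperP; split=> [x|].
    rewrite !inE => /andP[+ xD]; rewrite xD andbT negb_and negb_or negbK.
    case/orP => [/eqP xc|/andP[]//]; by rewrite -xc xD in cD.
  by exists a; rewrite !inE ?aD ?aT // eqxx andbT eq_sym ca.
- by apply: succn_inj; rewrite -card_fsetD1.
exists (- (sgn s a * sgn s c) * e1), T'; split=> //.
- by rewrite mulrACA e1e1 mulr1 mulrNN mulrACA !sgn_sq mulr1.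
- apply: fsubset_trans T'D _; rewrite fsubUset fsubsetUl /=.
  apply/fsubsetP => x; rewrite !inE => /andP[_ /orP[/eqP->|->]]; rewrite ?aD ?orbT //.
move=> G F AG GD shF FG.
have ED : a |` (D `&` T) `<=` D.
  by rewrite fsubUset fsub1set aD fsubsetIl.
(* Aligning with [G] on the common vertices and [a] is exactly the hypothesis needed for the
   induction on the new support. *)
have [|||||||||F1 [shF1 F1G FF1]] := @shell_step _ _ _ hA hCA hS B s a b c
  (a |` (D `&` T)) F (restr G (fpowerset (a |` (D `&` T)))) aTn sa sb sc.
- by rewrite eq_sym.
- by rewrite eq_sym.
- exact: bc.
- by rewrite /s fsetU1K.
- exact: restr_fpowerset_in.
- by rewrite (restr_fpowerset_dom hA) // GD fpowersetE.
- exact: fset1U1.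
- apply/fsubsetP => x; rewrite !inE => /orP[/eqP ->|/andP[xD xT]].
    by rewrite eqxx eq_sym ca eq_sym ba.
  rewrite xT orbT andbT; apply/andP; split; first by apply: contraNneq cD => <-.
  by apply: contraNneq bD => <-.
- rewrite fsetU1K; last by rewrite !inE (negPf aT) andbF.
  by rewrite restr_restr // fpowersetS fsubsetUr.
have [|F2 [shF2 F2G F1F2]] := mv G F1 AG GD shF1; first by rewrite sDE.
exists F2; split=> //; rewrite -scalerA.
by rewrite /s fsetU1K // in FF1; apply: homol_trans FF1 _; apply: homolZ.
Qed.

(** [F2] is moved off [T], where alignment with a face of [F1] asks for agreement on the empty set
    only, and then onto that face. The two shells now share a face and can be joined, and the
    resulting third shell is moved back to [T]. *)
Lemma shells_combine T : #|` T| = n.+2 ->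
  exists e e', [/\ e * e = 1, e' * e' = 1 & forall F1 F2, shell T F1 -> shell T F2 ->
    exists2 F3, shell T F3 & bdry F1 T + e *: bdry F2 T ~h e' *: bdry F3 T].
Proof.
move=> Tn; have [T2 [T2n TT2]] := exists_disjoint T n.+2.
have [e1 e1e1 m1] := moves_exists Tn T2n.
have [b bT _] : exists2 b, b \in T & b \notin fset0.
  by apply: card_gtD; rewrite Tn cardfs0.
have Dn : #|` T `\ b| = n.+1 by apply: succn_inj; rewrite -card_fsetD1.
have [c cT] : exists2 c, c \in T & c \notin [fset b].
  by apply: card_gtD; rewrite Tn cardfs1.
rewrite inE => cb.
have [e2 [T' [e2e2 T'n DT' T'D m2]]] := shell_align Dn T2n.
have [a aT' aD] : exists2 a, a \in T' & a \notin T `\ b.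
  by apply: card_gtD; rewrite T'n Dn.
(* [T'] is covered by [D] and [T2], so [a] comes from [T2]; in particular it is not [b]. *)
have aT : a \notin T.
  have : a \in (T `\ b) `|` T2 by apply: (fsubsetP T'D).
  by rewrite inE (negPf aD) => /TT2.
have T'E : T' = a |` (T `\ b).
  apply/esym/eqP; rewrite eqEfcard fsubUset fsub1set aT' DT' card_fsetU1 //.
  by rewrite Dn T'n /=.
have ba : b != a by apply: contraNneq aT => <-.
have ca : c != a by apply: contraNneq aT => <-.
have aTn := card_fsetU1 aT; rewrite Tn in aTn.
have saT : (a |` T) `\ a = T by rewrite fsetU1K.
have sbT : (a |` T) `\ b = T'.
  rewrite T'E; apply/fsetP => x; rewrite !inE.
  by case: (eqVneq x a) => //= ->; rewrite eq_sym ba.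
set s := a |` T in aTn saT sbT.
have [sa sb sc] : [/\ a \in s, b \in s & c \in s] by rewrite !inE bT cT eqxx !orbT.
have scn : #|` s `\ c| = n.+2 by apply: succn_inj; rewrite -card_fsetD1.
have [e3 e3e3 m3] := moves_exists scn Tn.
exists (sgn s a * sgn s b * (e1 * e2)), (- (sgn s a * sgn s c * e3)); split.
- by rewrite mulrACA (mulrACA e1) e1e1 e2e2 (mulrACA (sgn s a)) !sgn_sq !mulr1.
- by rewrite mulrNN mulrACA e3e3 mulrACA !sgn_sq !mulr1.
move=> F1 F2 sh1 sh2; have [F2' sh2' F22'] := m1 F2 sh2.
have [AF1 F1T F1B] := sh1.
have DF1 : T `\ b \in fdom F1 by rewrite F1T in_fboundary fproperD1.
have [|||F2'' [sh2'' F2''D F2'F2'']] :=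
  m2 (restr F1 (fpowerset (T `\ b))) F2' _ _ sh2'.
- exact: restr_fpowerset_in.
- exact: (restr_fpowerset_dom hA).
- have -> : (T `\ b) `&` T2 = fset0.
    apply/fsetP => x; rewrite !inE andbC; case: (boolP (x \in T2)) => // /TT2/negPf->.
    by rewrite andbF.
  rewrite restr_restr ?fpowersetS ?fsub0set //; apply: restr_fset0 => //.
  by case: sh2'.
have [||||||F3 [sh3 _ _ hom]] := @shell_join _ _ _ hA hCA B s a b c F1 F2'' aTn sa sb sc.
- by rewrite eq_sym.
- by rewrite eq_sym.
- by rewrite eq_sym.
- by rewrite saT.
- by rewrite sbT.
- by rewrite saT F2''D.
have [F4 sh4 F34] := m3 F3 sh3; exists F4 => //.
have F2F2'' : bdry F2 T ~h (e1 * e2) *: bdry F2'' T'.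
  by apply: homol_trans F22' _; rewrite -scalerA; apply: homolZ.
rewrite saT sbT in hom.
(* Scaling by [sgn s a] gives [F1] coefficient one; then [F3] is traded for [F4], and [F2''] for
   [F2]. *)
have hom1 := homolD (homolZ (sgn s a) hom) (homolZ (- (sgn s a * sgn s c)) F34).
have hom2 := homolD hom1 (homolZ (sgn s a * sgn s b * (e1 * e2)) F2F2'').
move: hom2; rewrite /homol !scalerDr !scalerA scaler0 sgn_sq scale1r add0r.
rewrite -[_ * (e1 * e2) * (e1 * e2)]mulrA (mulrACA e1) e1e1 e2e2 !mulr1 mulNr.
set k := sgn s a * sgn s b; set l := sgn s a * sgn s c.
rewrite [- l *: _]scaleNr addrK opprD addrA; set y := k *: _; set z := (k * _) *: _.
by rewrite [_ + y + z]addrAC [_ + y - _]addrAC addrK.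
Qed.

Lemma absorb_sign T F e : #|` T| = n.+2 -> shell T F -> e * e = 1 ->
  exists2 F', shell T F' & e *: bdry F T ~h bdry F' T.
Proof.
move=> Tn shF /eqP; rewrite -expr2 sqrf_eq1 => /orP[] /eqP ->.
  by exists F; rewrite // scale1r; apply: homol_refl.
have [F' shF' FF'] := moves_opp Tn shF; exists F' => //.
apply: homol_trans (homolZ (-1) FF') _.
by rewrite scalerA mulrNN mulr1 scale1r; apply: homol_refl.
Qed.

(** The signs of [shells_combine] depend on [T] only, so one can be absorbed into [F2] beforehand
    and the other into the result. *)
Lemma shells_add T F1 F2 : #|` T| = n.+2 -> shell T F1 -> shell T F2 ->
  exists2 F3, shell T F3 & bdry F1 T + bdry F2 T ~h bdry F3 T.
Proof.
move=> Tn sh1 sh2; have [e [e' [ee e'e' comb]]] := shells_combine Tn.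
have [F2' sh2' F22'] := absorb_sign Tn sh2 ee.
have [F3 sh3 F123] := comb F1 F2' sh1 sh2'.
have [F4 sh4 F34] := absorb_sign Tn sh3 e'e'; exists F4 => //.
apply: homol_trans F34; apply: homol_trans F123; apply: homolD (homol_refl _ _ _ _) _.
by have := homolZ e F22'; rewrite scalerA ee scale1r.
Qed.

End ShellGroup.

(** * Cones *)

Lemma fpowerset_inj : injective (@fpowerset nat).
Proof.
move=> u v uv; apply/eqP; rewrite eqEfsubset -[u `<=` v]fpowersetS.
by rewrite -[v `<=` u]fpowersetS uv fsubset_refl.
Qed.

Section Cones.
Local Open Scope ring_scope.
Context (C : category) (A : set (functor C)) (n : nat).
Context (hA : amenable A) (hCA : complete_amalgamation A n.+1).
Context (hS : strong_2_amalgamation A) (hn : (1 <= n)%N).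
Context (B : C) (hB : exists f : functor C, A f /\ over_base B f).
Implicit Types (f g F G : functor C) (K : functor C -> functor C).
Implicit Types (s t u w D E T : {fset nat}) (p q r : chain C).

Local Notation "p ~h q" := (homol A n B p q) (at level 70).
Local Notation shell := (shell_on A B).

(** A face-compatible choice of cones with apex [a], over simplices with fewer than [k] vertices. As
    [K] depends on the functor alone, a face shared by several simplices gets the same cone each
    time. *)
Definition cone_below a k K : Prop := forall f u,
  A f -> fdom f = fpowerset u -> a \notin u -> (#|` u| < k)%N ->
  [/\ A (K f), fdom (K f) = fpowerset (a |` u), restr (K f) (fpowerset u) = f
    & forall w, w `<=` u ->
      restr (K f) (fpowerset (a |` w)) = K (restr f (fpowerset w))].

(** [f] and the cones over its proper faces are compatible, and together cover every proper subset
    of [u] with [a] added. *)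
Lemma cone_boundary a k K f u : cone_below a k K ->
  A f -> fdom f = fpowerset u -> a \notin u -> #|` u| = k ->
  exists F, [/\ A F, fdom F = fboundary (a |` u), restr F (fpowerset u) = f
    & forall w, w `<` u ->
      restr F (fpowerset (a |` w)) = K (restr f (fpowerset w))].
Proof.
move=> coneK Af fu au uk.
pose H t := if a \in t then K (restr f (fpowerset (t `\ a)))
            else restr f (fpowerset t).
have tau t : t `<` a |` u -> a \in t -> t `\ a `<` u.
  move=> tu at_; rewrite fproperEneq; apply/andP; split.
    by apply: contraTneq tu => <-; rewrite fsetD1K // fproper_irrefl.
  apply/fsubsetP => x; rewrite !inE => /andP[xa xt].
  by have := fsubsetP (fproper_sub tu) x xt; rewrite !inE (negPf xa).
have tu t : t `<` a |` u -> a \notin t -> t `<=` u.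
  move=> /fproper_sub/fsubsetP tu at_; apply/fsubsetP => x xt.
  by have := tu x xt; rewrite !inE => /orP[/eqP xa|//]; rewrite -xa xt in at_.
have Kt w : w `<` u -> let g := restr f (fpowerset w) in
    [/\ A (K g), fdom (K g) = fpowerset (a |` w), restr (K g) (fpowerset w) = g
      & forall w', w' `<=` w ->
        restr (K g) (fpowerset (a |` w')) = K (restr g (fpowerset w'))].
  move=> wu; apply: coneK; first exact: (restr_fpowerset_in hA).
  - by rewrite (restr_fpowerset_dom hA) // fu fpowersetE fproper_sub.
  - by apply: contra au; apply: (fsubsetP (fproper_sub wu)).
  - by rewrite -uk fproper_ltn_card.
have aub : fset0 `<` a |` u by rewrite fproper0; apply/fset0Pn; exists a; rewrite fset1U1.
have [|||||F [AF Fdom FH]] := @glue_family_in _ _ hA (fboundary (a |` u)) H.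
- by apply/fset0Pn; exists fset0; rewrite in_fboundary.
- exact: down_closed_fboundary.
- move=> t; rewrite in_fboundary /H => ht; case: ifP => [/(tau _ ht)/Kt[]//|_].
  exact: (restr_fpowerset_in hA).
- move=> t; rewrite in_fboundary /H => ht; case: ifP => [at_|/negbT at_].
    by have [_ -> _ _] := Kt _ (tau _ ht at_); rewrite fsetD1K.
  by rewrite (restr_fpowerset_dom hA) // fu fpowersetE; apply: tu.
- move=> t t'; rewrite in_fboundary /H => ht' tt'.
  have [at'|at'] := boolP (a \in t'); last first.
    rewrite ifF; last by apply: contraNF at'; apply: (fsubsetP tt').
    by rewrite restr_restr // fpowersetS.
  have [_ _ Kf Kw] := Kt _ (tau _ ht' at'); case: ifP => [at_|/negbT at_].
    have := Kw (t `\ a); rewrite fsetD1K // restr_restr ?fpowersetS ?fsetSD //.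
    exact.
  have tta : t `<=` t' `\ a by rewrite fsubsetD1 tt'.
  rewrite -(@restr_restr _ _ (fpowerset (t' `\ a))) ?fpowersetS // Kf.
  by rewrite restr_restr ?fpowersetS.
exists F; split=> //.
  rewrite FH /H ?(negPf au) ?restr_id ?fu //.
  rewrite in_fboundary fproperEcard fsubsetUr cardfsU1 au /=; lia.
move=> w wu; have aw : a \notin w by apply: contra au; apply: (fsubsetP (fproper_sub wu)).
rewrite FH /H ?fset1U1 ?fsetU1K // in_fboundary fproperEcard.
by rewrite fsetUS ?fproper_sub // !cardfsU1 au aw /= !add1n ltnS fproper_ltn_card.
Qed.

(** By induction on [k]: the cone over a simplex with [k] vertices has k + 1 vertices, at most n + 1
    in the inductive step, so its boundary can be filled. Choice turns the fillings into a function,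
    and smaller simplices keep their cones. *)
Lemma cone_exists a k : (k <= n.+1)%N -> exists K, cone_below a k K.
Proof.
elim: k => [|k IHk] kn; first by exists id.
have [K coneK] := IHk (ltnW kn).
pose R f g := forall u, A f -> fdom f = fpowerset u -> a \notin u ->
  ((#|` u| < k)%N -> g = K f) /\
  (#|` u| = k -> [/\ A g, fdom g = fpowerset (a |` u), restr g (fpowerset u) = f
    & forall w, w `<` u -> restr g (fpowerset (a |` w)) = K (restr f (fpowerset w))]).
have [|K' K'P] := @choice _ _ R.
  move=> f; have [|nf] := pselect (exists u,
      [/\ A f, fdom f = fpowerset u, a \notin u & #|` u| = k]); last first.
    exists (K f) => u Af fu au; split=> // uk.
    by case: nf; exists u.
  move=> [u [Af fu au uk]].
  have [F [AF FT Fu Fw]] := cone_boundary coneK Af fu au uk.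
  have [||g [Ag gT gF]] := fill_boundary hA hCA _ _ AF FT.
  - by apply/fset0Pn; exists a; rewrite fset1U1.
  - by rewrite cardfsU1 au uk.
  exists g => u' _; rewrite fu => /fpowerset_inj <- _; split=> [|_].
    by rewrite uk ltnn.
  have sub w : w `<` a |` u -> fpowerset w `<=` fboundary (a |` u).
    move=> wu; apply/fsubsetP => x; rewrite fpowersetE in_fboundary => xw.
    exact: fsub_proper_trans wu.
  split=> //.
    rewrite -[RHS]Fu -gF restr_restr // sub // fproperEcard fsubsetUr.
    by rewrite cardfsU1 au /=; lia.
  move=> w wu; rewrite -Fw // -gF restr_restr // sub // fproperEcard.
  have aw : a \notin w by apply: contra au; apply: (fsubsetP (fproper_sub wu)).
  by rewrite fsetUS ?fproper_sub // !cardfsU1 au aw /= !add1n ltnS fproper_ltn_card.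
exists K' => f u Af fu au; rewrite ltnS => uk.
have K'K w : w `<=` u -> (#|` w| < k)%N ->
    K' (restr f (fpowerset w)) = K (restr f (fpowerset w)).
  move=> wu wk; apply: (K'P _ w _ _ _).1 => //.
  - exact: (restr_fpowerset_in hA).
  - by rewrite (restr_fpowerset_dom hA) // fu fpowersetE.
  - by apply: contra au; apply: (fsubsetP wu).
have fidu : restr f (fpowerset u) = f by rewrite restr_id // fu.
move: uk; rewrite leq_eqVlt => /orP[/eqP uk|uk]; last first.
  have [AK Kdom Ku Kw] := coneK f u Af fu au uk.
  have -> : K' f = K f by rewrite -fidu K'K.
  split=> // w wu; rewrite K'K ?Kw //.
  exact: leq_ltn_trans (fsubset_leq_card wu) uk.
have [AK' K'dom K'u K'w] := (K'P f u Af fu au).2 uk.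
split=> // w; rewrite fsubEproper => /orP[/eqP ->|wu].
  by rewrite fidu restr_id // K'dom.
by rewrite K'w // K'K ?fproper_sub // -uk fproper_ltn_card.
Qed.

Lemma sgn_fsetU1 a u x : (forall y, y \in u -> (y < a)%N) -> x \in u ->
  sgn (a |` u) x = sgn u x.
Proof.
move=> ua xu; rewrite /sgn (belowD1 _ a) ltnNge ltnW ?ua // andbF /= fsetU1K //.
by apply/negP => /ua; rewrite ltnn.
Qed.

Lemma sgn_top a u : (forall y, y \in u -> (y < a)%N) ->
  sgn (a |` u) a = (-1) ^+ #|` u|.
Proof.
move=> ua; rewrite /sgn /below; congr (_ ^+ #|` _|); apply/fsetP => y.
rewrite !inE /=; case: (eqVneq y a) => [->|ya] /=.
  by rewrite ltnn; apply/esym/negP => /ua; rewrite ltnn.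
by apply: andb_idr; apply: ua.
Qed.

Lemma sum_coeff_basis (c : chain C) :
  c = \sum_(f <- dom c) coeff f c *: basis f.
Proof.
rewrite -[LHS]freeg_sumE; apply: eq_bigr => f _.
by apply/eqP/freeg_eqP => g; rewrite coeffZ !coeffU mul1r.
Qed.

(** A cone over n + 1 vertices need not be filled, but its boundary exists. With the apex above all
    vertices, the base gets the last sign and the other signs are those in the differential of
    [f]. *)
Lemma cone_shell a K f u : cone_below a n.+1 K -> A f -> over_base B f ->
  fdom f = fpowerset u -> #|` u| = n.+1 -> (forall y, y \in u -> (y < a)%N) ->
  exists2 F, shell (a |` u) F & bdry F (a |` u) =
    (-1) ^+ n.+1 *: basis f +
    fglift (fun g : {classic (functor C)} => basis (K g)) (bd n (basis f)).
Proof.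
move=> coneK Af fB fu un ua.
have au : a \notin u by apply/negP => /ua; rewrite ltnn.
have [F [AF FT Fu Fw]] := cone_boundary coneK Af fu au un.
exists F; first by split=> //; apply: over_extend Fu fB.
rewrite (bd_basis fu un) /bdry big_fsetU1 //= sgn_top // un fsetU1K // Fu.
congr (_ + _); rewrite linear_sum /=; apply: eq_big_seq => x xu.
rewrite linearZ /= sgn_fsetU1 // /basis liftU scale1r; congr (_ *: << _ >>).
have -> : (a |` u) `\ x = a |` (u `\ x).
  apply/fsetP => y; rewrite !inE; case: (eqVneq y a) => //= ->.
  by rewrite andbT; apply: contraNneq au => ->.
by rewrite Fw // fproperD1.
Qed.

(* The coned faces cancel because the cycle has no boundary, so a cycle is, up
   to sign, the sum of the shells with which it is coned off. *)
Lemma cycle_sum_shells c : cycles A B n c ->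
  exists (F : functor C -> functor C) (T : functor C -> {fset nat}),
    (forall f, f \in dom c -> #|` T f| = n.+2 /\ shell (T f) (F f)) /\
    c = \sum_(f <- dom c) ((-1) ^+ n.+1 * coeff f c) *: bdry (F f) (T f).
Proof.
move=> [chc bdc].
have [a afresh] := exists_fresh (chain_supp c).
have [K coneK] := cone_exists a (leqnn n.+1).
pose L := fglift (fun g : {classic (functor C)} => basis (K g)).
have [|F FP] := @choice _ _ (fun f F => f \in dom c ->
    shell (a |` supp f) F /\
    bdry F (a |` supp f) = (-1) ^+ n.+1 *: basis f + L (bd n (basis f))).
  move=> f; have [fc|nfc] := boolP (f \in dom c); last by exists f.
  have [Af [u [un fu]] fB] := chc f fc.
  have suppf := supp_simplex fu.
  have [|F shF FE] := cone_shell coneK Af fB fu un (a := a).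
    move=> y yu; apply: afresh; rewrite /chain_supp.
    by apply/bigfcupP; exists f; rewrite ?fc // suppf.
  by exists F => _; rewrite suppf.
exists F, (fun f => a |` supp f); split.
  move=> f fc; have [shF _] := FP f fc; split=> //.
  have [Af [u [un fu]] fB] := chc f fc.
  rewrite (supp_simplex fu) cardfsU1 un; case: (boolP (a \in u)) => // au.
  suff /afresh : a \in chain_supp c by rewrite ltnn.
  by apply/bigfcupP; exists f; rewrite ?fc // (supp_simplex fu).
rewrite [LHS]sum_coeff_basis.
have -> : \sum_(f <- dom c) ((-1) ^+ n.+1 * coeff f c) *: bdry (F f) (a |` supp f) =
    \sum_(f <- dom c) (coeff f c *: basis f +
      ((-1) ^+ n.+1 * coeff f c) *: L (bd n (basis f))).
  apply: eq_big_seq => f fc; have [_ ->] := FP f fc.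
  by rewrite scalerDr scalerA mulrAC -expr2 sqrr_sign mul1r.
rewrite big_split /= [X in _ = _ + X](_ : _ = 0) ?addr0 //.
transitivity (L ((-1) ^+ n.+1 *: bd n c)); last by rewrite bdc scaler0 /L linear0.
rewrite /L linearZ /= [in RHS](sum_coeff_basis c) !linear_sum /=; apply: eq_bigr => f _.
by rewrite [bd n (_ *: _)]linearZ [fglift _ (_ *: _)]linearZ scalerA.
Qed.

(** Being homologous to one shell on [T] is preserved by sums and negation, and holds of zero
    because a shell exists. It thus passes to the integer combination of [cycle_sum_shells], once
    each shell is moved to [T]. *)
Lemma cycle_homol_shell T c : #|` T| = n.+2 -> cycles A B n c ->
  exists2 F, shell T F & c ~h bdry F T.
Proof.
move=> Tn /cycle_sum_shells[F [S [shF ->]]].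
pose P p := exists2 F, shell T F & p ~h bdry F T.
have PD p q : P p -> P q -> P (p + q).
  move=> [F1 sh1 h1] [F2 sh2 h2].
  have [F3 sh3 h3] := shells_add hA hCA hS hn hB Tn sh1 sh2.
  by exists F3 => //; apply: homol_trans h3; apply: homolD.
have PN p : P p -> P (- p).
  move=> [F1 sh1 h1]; have [F2 sh2 h2] := moves_opp hA hCA hS hn hB Tn sh1.
  exists F2 => //; have := homolZ (-1) (homol_trans h1 h2).
  by rewrite scalerA mulrNN mulr1 scale1r scaleN1r.
have P0 : P 0.
  have [F1 sh1] := exists_shell hA hCA hB Tn.
  rewrite -(subrr (bdry F1 T)).
  by apply: PD; last apply: PN; exists F1 => //; apply: homol_refl.
have PZ k p : P p -> P (k *: p).
  move=> Pp; have Pn (m : nat) : P (m%:Z *: p).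
    elim: m => [|m IHm]; first by rewrite scale0r.
    by rewrite -addn1 PoszD scalerDl scale1r; apply: PD.
  by case: k => m; rewrite ?NegzE ?scaleNr //; apply: PN.
suff PF f : f \in dom c -> P (bdry (F f) (S f)).
  rewrite big_seq; apply: (big_ind P) => // f fc; exact/PZ/PF.
move=> /shF[Sn shf].
have [e ee mv] := moves_exists hA hCA hS hn hB Sn Tn.
have [F1 sh1 h1] := mv _ shf.
have [F2 sh2 h2] := absorb_sign hA hCA hS hn hB Tn sh1 ee.
by exists F2 => //; apply: homol_trans h2.
Qed.

End Cones.

(** * Shells as chains *)

Lemma nth_below (s : {fset nat}) x : x \in s ->
  nth 0%N (sort leq s) (below s x) = x.
Proof.
move=> xs; have xi : (index x (sort leq s) < #|` s|)%N.
  by rewrite -size_sort_fset index_mem mem_sort.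
have xE : nth 0%N (sort leq s) (index x (sort leq s)) = x by rewrite nth_index ?mem_sort.
by rewrite -{1}xE below_nth.
Qed.

Section ShellChains.
Local Open Scope ring_scope.
Context (C : category) (A : set (functor C)) (n : nat) (hA : amenable A) (B : C).
Implicit Types (f g F : functor C) (T : {fset nat}).

(** Faces omitting different vertices have different domains, so no two terms can cancel. *)
Lemma mem_dom_bdry F T x : A F -> fdom F = fboundary T -> x \in T ->
  (restr F (fpowerset (T `\ x)) : {classic (functor C)}) \in dom (bdry F T).
Proof.
move=> AF FT xT; have faceT y : y \in T ->
      fdom (restr F (fpowerset (T `\ y))) = fpowerset (T `\ y).
  by move=> yT; rewrite (restr_fpowerset_dom hA) // FT in_fboundary fproperD1.
rewrite mem_dom /bdry raddf_sum (big_fsetD1 x) //= big_seq big1 ?addr0.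
  by rewrite coeffZ coeffU eqxx !mulr1 /sgn signr_eq0.
move=> y; rewrite !inE => /andP[yx yT]; rewrite coeffZ coeffU mul1r.
suff /negPf -> : (restr F (fpowerset (T `\ y)) : {classic (functor C)}) !=
    restr F (fpowerset (T `\ x)) by rewrite mulr0.
apply: contra_neq yx => /(congr1 (@fdom C)); rewrite !faceT // => /fpowerset_inj TE.
by have /fsetP/(_ y) := TE; rewrite !inE eqxx yT andbT /=; case: eqP.
Qed.

Lemma chain_supp_bdry F T : A F -> fdom F = fboundary T -> (1 < #|` T|)%N ->
  chain_supp (bdry F T) = T.
Proof.
move=> AF FT T2; have suppT x : x \in T -> supp (restr F (fpowerset (T `\ x))) = T `\ x.
  move=> xT; apply: supp_simplex.
  by rewrite (restr_fpowerset_dom hA) // FT in_fboundary fproperD1.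
apply/eqP; rewrite eqEfsubset; apply/andP; split; apply/fsubsetP => x.
  move=> /bigfcupP[f /andP[+ _]]; rewrite mem_dom /bdry raddf_sum /= => fc xf.
  have [y yT yf] : exists2 y, y \in T & f = restr F (fpowerset (T `\ y)).
    apply: contrapT => nf; move: fc; rewrite big_seq big1 ?eqxx // => y yT.
    rewrite coeffZ coeffU mul1r; case: eqP => [fE|_]; last by rewrite mulr0.
    by case: nf; exists y.
  by move: xf; rewrite yf suppT // inE => /andP[].
move=> xT; have [y yT] : exists2 y, y \in T & y \notin [fset x].
  by apply: card_gtD; rewrite cardfs1.
rewrite inE => yx; apply/bigfcupP.
exists (restr F (fpowerset (T `\ y))); first by rewrite andbT mem_dom_bdry.
by rewrite suppT // !inE eq_sym yx.
Qed.

Lemma shell_bdry F T : #|` T| = n.+2 -> shell_on A B T F ->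
  shell A B n (bdry F T).
Proof.
move=> Tn [AF FT FB]; pose t i := nth 0%N (sort leq T) i.
have szT : size (sort leq T) = n.+2 by rewrite size_sort_fset.
have tT i : (i < n.+2)%N -> t i \in T.
  by move=> iltn; rewrite -(mem_sort leq) mem_nth // szT.
have faceT y : y \in T ->
      fdom (restr F (fpowerset (T `\ y))) = fpowerset (T `\ y).
  by move=> yT; rewrite (restr_fpowerset_dom hA) // FT in_fboundary fproperD1.
exists (fun i : 'I_n.+2 => restr F (fpowerset (T `\ t i))); split.
- move=> i; have ti := tT i (ltn_ord i); split.
  + exact: (restr_fpowerset_in hA).
  + exists (T `\ t i); split; last exact: faceT.
    by apply: succn_inj; rewrite -card_fsetD1.
  + by apply: over_restr; rewrite // fpowersetE fsub0set.
- move=> i j ij; have [ti tj] := (tT i (ltn_ord i), tT j (ltn_ord j)).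
  rewrite /face !(supp_simplex (faceT _ _)) //.
  have tij : (t i < t j)%N.
    by apply: (sorted_ltn_nth ltn_trans 0%N (sort_fset_sorted T)); rewrite ?inE ?szT.
  have bi : below T (t i) = i by rewrite below_nth // Tn.
  have bj : below T (t j) = j by rewrite below_nth // Tn.
  (* Deleting the larger vertex keeps the position of [t i]; deleting the smaller lowers that of
     [t j] by one, whence [j.-1]. *)
  have -> : nth 0%N (sort leq (T `\ t j)) i = t i.
    have := belowD1 T (t j) (t i); rewrite ltnNge ltnW // andbF bi add0n => {1}->.
    by rewrite nth_below // !inE ti ltn_eqF.
  have -> : nth 0%N (sort leq (T `\ t i)) j.-1 = t j.
    have := belowD1 T (t i) (t j); rewrite ti tij bj /= add1n => {1}-> /=.
    by rewrite nth_below // !inE tj gtn_eqF.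
  rewrite !restr_restr ?fpowersetS ?fsubD1set //.
  by rewrite !fsetDDl fsetUC.
- left; apply/esym.
  exact: (sum_sorted (fun x => basis (restr F (fpowerset (T `\ x)))) Tn).
Qed.

(** Faces of the [f i] correspond to ordered pairs of distinct vertices; the shell condition
    identifies the faces of (x, y) and (y, x), which carry opposite signs. *)
Lemma shell_cycle c : shell A B n c -> cycles A B n c.
Proof.
move=> [f [fS fface cE]].
suff SC : cycles A B n (\sum_(i < n.+2) (-1) ^+ i *: basis (f i)).
  case: cE => -> //; case: SC => chS bdS; split; last by rewrite linearN /= bdS oppr0.
  by rewrite -scaleN1r -[_ *: _]addr0; apply: chainsP chS (chains0 _ _ _).
split.
  apply: chains_sum => i _; rewrite -[_ *: _]addr0; apply: chainsP.
    exact: chains_basis.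
  exact: chains0.
rewrite linear_sum /=.
(* [unbump x y] is the position of the vertex numbered [y] once the one numbered [x] is removed. *)
pose t (x y : 'I_n.+2) : chain C :=
  (-1 : int) ^+ x *: ((-1 : int) ^+ unbump x y *: basis (face (unbump x y) (f x))).
have tE (i : 'I_n.+2) : bd n ((-1) ^+ i *: basis (f i)) =
    \sum_(y <- index_enum 'I_n.+2 | y != i) t i y.
  rewrite linearZ /= /bd /basis liftU scale1r scaler_sumr.
  rewrite [RHS]big_mkcond (bigD1_ord i) //= eqxx add0r; apply: eq_bigr => j _.
  by rewrite eq_sym neq_lift /t /= bumpK.
under eq_bigr => i _ do rewrite tE.
apply: (antisym_sum (m := @nat_of_ord n.+2)); first exact: ord_inj.
move=> x y _ _ xy; rewrite /t !scalerA -!exprD -scaleNr.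
have -> : unbump x y = y.-1 by rewrite /unbump xy subn1.
have -> : unbump y x = x by rewrite /unbump ltnNge ltnW ?subn0.
rewrite (fface x y xy); congr (_ *: _).
rewrite -[in RHS](prednK (leq_ltn_trans (leq0n x) xy)) addSn addnC.
by rewrite exprS mulN1r opprK.
Qed.

End ShellChains.

Lemma hclass_homol (C : category) (A : set (functor C)) (n : nat) (B : C)
    (p q : chain C) : homol A n B p q -> hclass A B n p = hclass A B n q.
Proof.
have sub (x y : chain C) : homol A n B x y ->
    (hclass A B n x `<=` hclass A B n y)%classic.
  move=> xy _ [b hb <-]; exists (x - y + b)%R; first exact: boundariesD.
  by rewrite addrA [(y + _)%R]addrC subrK.
by move=> pq; apply/seteqP; split; apply: sub => //; apply: homol_sym.
Qed.

Theorem theorem1p37 (C : category) (A : set (functor C)) (n : nat)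
    (hA : amenable A) (hnt : nontrivial A) (hn : (1 <= n)%N)
    (hCA : complete_amalgamation A n.+1)
    (B : C) (hB : exists f : functor C, A f /\ over_base B f) :
  homology A B n =
  ([set hclass A B n c | c in
      [set c | shell A B n c /\ chain_supp c = brack n.+1]])%classic.
Proof.
have Tn := card_brack n.+1; have [_ _ hS] := hnt.
apply/seteqP; split=> _ [c hc <-]; last first.
  by exists c => //; apply: (shell_cycle hc.1).
have [F shF cF] := cycle_homol_shell hA hCA hS hn hB Tn hc.
exists (bdry F (brack n.+1)); last by apply/esym/hclass_homol.
have [AF FT _] := shF; split; first exact: shell_bdry.
by apply: (chain_supp_bdry hA AF FT); rewrite Tn.
Qed.
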